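(* The function $\mathfrak{A}$ has no zeros off the ray $e^{-i\pi/3}\,\mathbb{R}^+$; that is, if $z_0 \in \mathbb{C}$ does not lie on the ray $e^{-i\pi/3}\,\mathbb{R}^+$, then $\mathfrak{A}(z_0) \neq 0$.
   Context: $\mathrm{Ai}$ and $\mathrm{Bi}$ are the standard Airy functions, and $\mathfrak{A}(z) := -i\sqrt{\pi}\,\big(\mathrm{Ai}(z) + i\,\mathrm{Bi}(z)\big)$ for $z \in \mathbb{C}$. *)

(* Defs.v *)
(* Stdlib reals with Coquelicot: C is Coquelicot's type of complex numbers. *)
From Stdlib Require Import Reals Factorial Lra Lia.
From Coquelicot Require Export Coquelicot.
Open Scope R_scope.

(* Euler's integral of the second kind, as an improper Riemann integral at both
   ends; meaningful for s > 0. *)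
Definition Gamma (s : R) : R :=
  RInt_gen (fun t => Rpower t (s - 1) * exp (- t)) (at_right 0) (Rbar_locally p_infty).

(* Rising factorial (a)_k = a (a + 1) ... (a + k - 1). *)
Fixpoint pochhammer (a : R) (k : nat) : R :=
  match k with
  | O => 1
  | S k' => pochhammer a k' * (a + INR k')
  end.

(* Coquelicot's Series is real-valued; a complex series is summed componentwise.
   The series it is applied to converge: see is_series_airy_f, is_series_airy_g. *)
Definition CSeries (a : nat -> C) : C :=
  (Series (fun n => Re (a n)), Series (fun n => Im (a n))).

(* The solutions of w'' = z w with (w(0), w'(0)) = (1, 0) and (0, 1):
     f(z) = 1 + (1/3!) z^3 + (1.4/6!) z^6 + (1.4.7/9!) z^9 + ...
     g(z) = z + (2/4!) z^4 + (2.5/7!) z^7 + (2.5.8/10!) z^10 + ...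
   see Abramowitz-Stegun 10.4.3 or DLMF 9.4. *)
Definition airy_f_coef (k : nat) : R :=
  3 ^ k * pochhammer (1 / 3) k / INR (fact (3 * k)).

Definition airy_g_coef (k : nat) : R :=
  3 ^ k * pochhammer (2 / 3) k / INR (fact (3 * k + 1)).

Definition airy_f (z : C) : C :=
  CSeries (fun k => RtoC (airy_f_coef k) * z ^ (3 * k))%C.

Definition airy_g (z : C) : C :=
  CSeries (fun k => RtoC (airy_g_coef k) * z ^ (3 * k + 1))%C.

(* airy_c1 = Ai(0) and airy_c2 = - Ai'(0). *)
Definition airy_c1 : R := Rpower 3 (- (2 / 3)) / Gamma (2 / 3).
Definition airy_c2 : R := Rpower 3 (- (1 / 3)) / Gamma (1 / 3).

(* Abramowitz-Stegun 10.4.2-10.4.5. *)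
Definition Ai (z : C) : C :=
  (RtoC airy_c1 * airy_f z - RtoC airy_c2 * airy_g z)%C.

Definition Bi (z : C) : C :=
  (RtoC (sqrt 3) * (RtoC airy_c1 * airy_f z + RtoC airy_c2 * airy_g z))%C.

Definition frakA (z : C) : C :=
  (- Ci * RtoC (sqrt PI) * (Ai z + Ci * Bi z))%C.

Definition cis (theta : R) : C := (cos theta, sin theta).

(* The open ray e^{i theta} (0, +oo): its endpoint 0 is excluded. *)
Definition on_ray (theta : R) (z : C) : Prop :=
  exists r : R, 0 < r /\ z = (cis theta * RtoC r)%C.

Lemma CSeries_correct (a : nat -> C) (l : C) :
  is_series a l -> CSeries a = l.
Proof.
intros H.
assert (Hc : forall (p : C -> R), (forall x y : C, p (plus x y) = p x + p y) ->
   (forall x, filterlim p (locally x) (locally (p x))) ->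
   is_series (fun n => p (a n)) (p l)).
{ intros p Hp Hl. unfold is_series.
  apply filterlim_ext with (fun n => p (sum_n a n)).
  - intros n. induction n as [|n IH].
    + now rewrite !sum_O.
    + now rewrite !sum_Sn, Hp, IH.
  - eapply filterlim_comp; [exact H | apply Hl]. }
unfold CSeries. destruct l as [x y]. f_equal.
- apply is_series_unique. apply (Hc Re); [now intros [? ?] [? ?]|].
  intros [u v] P [e He]; exists e. intros [u' v'] [B _]. apply He, B.
- apply is_series_unique. apply (Hc Im); [now intros [? ?] [? ?]|].
  intros [u v] P [e He]; exists e. intros [u' v'] [_ B]. apply He, B.
Qed.

(* The recurrences by which the two series formally solve w'' = z w. *)
Lemma airy_f_coef_rec (k : nat) :
  (3 * INR k + 3) * (3 * INR k + 2) * airy_f_coef (S k) = airy_f_coef k.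
Proof.
unfold airy_f_coef.
replace (3 * S k)%nat with (S (S (S (3 * k)))) by lia.
rewrite !fact_simpl, !mult_INR, !S_INR, mult_INR; simpl (INR 3); simpl pochhammer; simpl pow.
assert (Hf := INR_fact_neq_0 (3 * k)); assert (Hk := pos_INR k).
field; repeat split; try lra; exact Hf.
Qed.

Lemma airy_g_coef_rec (k : nat) :
  (3 * INR k + 4) * (3 * INR k + 3) * airy_g_coef (S k) = airy_g_coef k.
Proof.
unfold airy_g_coef.
replace (3 * S k + 1)%nat with (S (S (S (3 * k + 1)))) by lia.
rewrite !fact_simpl, !mult_INR, !S_INR, plus_INR, mult_INR; simpl (INR 3); simpl (INR 1);
  simpl pochhammer; simpl pow.
assert (Hf := INR_fact_neq_0 (3 * k + 1)); assert (Hk := pos_INR k).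
field; repeat split; try lra; exact Hf.
Qed.

Lemma ex_series_coef (c : nat -> R) (d : nat -> nat) (j : nat) (z : C) :
  0 <= c 0%nat <= 1 ->
  (forall k, exists q, INR (S k) <= q /\ q * c (S k) = c k) ->
  (forall k, d k = (3 * k + j)%nat) ->
  ex_series (fun k => RtoC (c k) * z ^ d k)%C.
Proof.
intros H0 Hrec Hd.
assert (Hc : forall k, 0 <= c k <= / INR (fact k)).
{ induction k as [|k IH]; [simpl; lra|].
  destruct (Hrec k) as [q [Hq E]].
  assert (Hk : 0 < INR (S k)) by (apply lt_0_INR; lia).
  assert (Hf := INR_fact_lt_0 k).
  assert (E' : c (S k) = c k / q) by (rewrite <- E; field; lra).
  rewrite E', fact_simpl, mult_INR, Rinv_mult.
  assert (0 < / q <= / INR (S k)).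
  { split; [apply Rinv_0_lt_compat; lra | apply Rinv_le_contravar; lra]. }
  unfold Rdiv; split; [apply Rmult_le_pos; lra|].
  rewrite Rmult_comm; apply Rmult_le_compat; lra. }
apply (ex_series_le (V := C_CompleteNormedModule) _
  (fun k => Cmod z ^ j * (/ INR (fact k) * (Cmod z ^ 3) ^ k))).
- intros k. change (norm (RtoC (c k) * z ^ d k)%C)
    with (Cmod (RtoC (c k) * z ^ d k)%C).
  rewrite Cmod_mult, Cmod_R, Cmod_pow, Hd, pow_add, pow_mult, Rabs_pos_eq by apply Hc.
  assert (H1 := pow_le (Cmod z) j (Cmod_ge_0 z)).
  assert (H2 := pow_le (Cmod z ^ 3) k (pow_le (Cmod z) 3 (Cmod_ge_0 z))).
  rewrite (Rmult_comm (_ ^ k)), <- Rmult_assoc, (Rmult_comm (c k)), Rmult_assoc.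
  apply Rmult_le_compat_l; [exact H1|].
  apply Rmult_le_compat_r; [exact H2|apply Hc].
- apply (ex_series_scal_l (V := R_NormedModule) (Cmod z ^ j)).
  exists (exp (Cmod z ^ 3)).
  eapply is_series_ext; [|apply (is_exp_Reals (Cmod z ^ 3))].
  intros n; cbv beta. rewrite pow_n_pow. apply Rmult_comm.
Qed.

Lemma ex_series_airy_f (z : C) :
  ex_series (fun k => RtoC (airy_f_coef k) * z ^ (3 * k))%C.
Proof.
apply ex_series_coef with (j := 0%nat); [|intros k|intros k; lia].
- unfold airy_f_coef; simpl; lra.
- exists ((3 * INR k + 3) * (3 * INR k + 2)); split; [|apply airy_f_coef_rec].
  assert (Hk := pos_INR k); rewrite S_INR; nra.
Qed.

Lemma ex_series_airy_g (z : C) :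
  ex_series (fun k => RtoC (airy_g_coef k) * z ^ (3 * k + 1))%C.
Proof.
apply ex_series_coef with (j := 1%nat); [|intros k|reflexivity].
- unfold airy_g_coef; simpl; lra.
- exists ((3 * INR k + 4) * (3 * INR k + 3)); split; [|apply airy_g_coef_rec].
  assert (Hk := pos_INR k); rewrite S_INR; nra.
Qed.

Lemma is_series_airy_f (z : C) :
  is_series (fun k => RtoC (airy_f_coef k) * z ^ (3 * k))%C (airy_f z).
Proof.
destruct (ex_series_airy_f z) as [l H].
unfold airy_f; rewrite (CSeries_correct _ _ H); exact H.
Qed.

Lemma is_series_airy_g (z : C) :
  is_series (fun k => RtoC (airy_g_coef k) * z ^ (3 * k + 1))%C (airy_g z).
Proof.
destruct (ex_series_airy_g z) as [l H].
unfold airy_g; rewrite (CSeries_correct _ _ H); exact H.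
Qed.

(* Main.v *)
Require Import Defs.
From Stdlib Require Import Reals.
From Coquelicot Require Import Coquelicot.
From Stdlib Require Import Factorial Lra Lia Psatz.

(** Since [f] is invariant under rotation by a cube root of unity and [g] is
    multiplied by it, [frakA z] is a nonzero constant times
    [Ai (e^(-2 i pi / 3) z)] ([frakA_rot]).  The ray [e^(-i pi / 3) R^+] is
    turned into the negative real axis, so the claim is that every zero of [Ai]
    is a negative real number.

    For a solution [W] of [W'' = z W] that is real on the real axis and decays
    at [+oo], this follows from a Wronskian argument
    ([recessive_zeros_negative]).  If [W z0 = 0] with [Im z0 <> 0], then along
    the half-line [z0 + t] the function [J = Im (W' conj W)] satisfies
    [J' = Im z0 |W|^2]; it vanishes at both ends, hence identically, so
    [W = 0].  On the nonnegative reals [W^2] is nonincreasing, so a zero there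
    again forces [W = 0].  The required decay on horizontal half-lines is
    obtained from superexponential decay on the real axis by an energy estimate
    in the vertical direction ([airy_energy_bound], [recessive_strip_decay]),
    and the real decay follows from the differential equation once [W W' <= 0]
    is known for [x >= 0] ([recessive_decay]).

    It remains to see that [Ai], which is defined by its values at the origin,
    is the recessive solution.  A solution [u] with [u u' > 0] at some
    [x0 >= 0] stays above a positive multiple of [g]
    ([recessive_prod_nonpos]), so it is enough that
    [f - ratio * g = o(g)] at [+oo], where [ratio = - Ai'(0) / Ai(0)].  Here
    the Gamma values enter.  Put [y = x^3 / 9] and
    [phi s = y^s / (Gamma (s + 1) Gamma (s + 2/3))]: up to a common constant
    the terms of [f] are the values of [phi] on the nonnegative integers [k],
    and the terms of [ratio * g] are its values at [k + 1/3].  As [phi] is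
    log-concave the two families interlace ([airy_terms_interlace_f],
    [airy_terms_interlace_g]), so their sums differ by at most the total
    variation of either family, which is negligible against the sum because the
    weights spread over many indices ([total_variation_small]).  Interlacing
    rests on Wendel's inequality [Gamma (s + q) <= s^q Gamma s]
    ([is_Gamma_wendel]), itself Bernoulli's inequality integrated against the
    density of [Gamma]. *)

(** * Calculus and Euler's integral *)

(** Moves an equation stated in the carrier of an abstract structure to [R],
    where [ring] and [field] recognize it. *)
Ltac as_real :=
  match goal with |- @eq _ ?a ?b => change (@eq R a b) end.

Lemma nondecr_of_derive (f df : R -> R) (a b : R) :
  a <= b ->
  (forall x, a <= x <= b -> is_derive f x (df x)) ->
  (forall x, a <= x <= b -> 0 <= df x) ->
  f a <= f b.
Proof.
intros Hab Hd Hp.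
destruct (MVT_gen f a b df) as [c [Hc E]].
- intros x Hx. rewrite Rmin_left, Rmax_right in Hx by lra. apply Hd; lra.
- intros x Hx. rewrite Rmin_left, Rmax_right in Hx by lra.
  apply continuity_pt_filterlim.
  apply (ex_derive_continuous (K := R_AbsRing) (V := R_NormedModule) f).
  exists (df x); apply Hd; lra.
- rewrite Rmin_left, Rmax_right in Hc by lra.
  specialize (Hp c Hc). nra.
Qed.

Definition euler_density (s t : R) : R := Rpower t (s - 1) * exp (- t).

(** The value together with convergence, which [Gamma] alone does not record. *)
Definition is_Gamma (s l : R) : Prop :=
  is_RInt_gen (euler_density s) (at_right 0) (Rbar_locally p_infty) l.

Lemma is_Gamma_unique (s l : R) : is_Gamma s l -> Gamma s = l.
Proof. intros H. apply (is_RInt_gen_unique _ _ H). Qed.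

Lemma is_derive_Rpower (s t : R) :
  0 < t -> is_derive (fun x => Rpower x s) t (s * Rpower t (s - 1)).
Proof. intros Ht. apply is_derive_Reals. now apply derivable_pt_lim_power. Qed.

Lemma euler_density_pos (s t : R) : 0 < euler_density s t.
Proof. apply Rmult_lt_0_compat; apply exp_pos. Qed.

Lemma continuous_euler_density (s t : R) : 0 < t -> continuous (euler_density s) t.
Proof.
intros Ht.
apply (ex_derive_continuous (K := R_AbsRing) (V := R_NormedModule)).
apply (ex_derive_mult (fun t => Rpower t (s - 1)) (fun t => exp (- t))).
- exists ((s - 1) * Rpower t (s - 1 - 1)). now apply is_derive_Rpower.
- auto_derive; trivial.
Qed.

Lemma ex_RInt_pos_continuous (f : R -> R) (a b : R) :
  (forall t, 0 < t -> continuous f t) -> 0 < a -> a <= b -> ex_RInt f a b.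
Proof.
intros Hf Ha Hab. apply (ex_RInt_continuous (V := R_CompleteNormedModule)).
intros z Hz. rewrite Rmin_left in Hz by lra. apply Hf; lra.
Qed.

Lemma at_right_0_lt (a : R) : 0 < a -> at_right 0 (fun x => 0 < x < a).
Proof.
intros Ha. exists (mkposreal a Ha). intros y Hy Hy0.
unfold ball in Hy; simpl in Hy; unfold AbsRing_ball, abs, minus, plus, opp in Hy; simpl in Hy.
apply Rabs_def2 in Hy. lra.
Qed.

(** Monotone convergence: with a nonnegative integrand the partial integrals
    increase as the interval grows, so a common bound forces a limit, which then
    dominates each of them. *)
Lemma is_RInt_gen_bounded (f : R -> R) (B : R) :
  (forall t, 0 < t -> continuous f t) ->
  (forall t, 0 < t -> 0 <= f t) ->
  (forall a b, 0 < a -> a <= b -> RInt f a b <= B) ->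
  exists l, is_RInt_gen f (at_right 0) (Rbar_locally p_infty) l /\
    forall a b, 0 < a -> a <= b -> RInt f a b <= l.
Proof.
intros Hc Hp HB.
set (E := fun v => exists a b, 0 < a /\ a <= b /\ v = RInt f a b).
destruct (completeness E) as [l [Hub Hlub]].
- exists B. intros v [a [b [Ha [Hab ->]]]]. now apply HB.
- exists (RInt f 1 1), 1, 1. repeat split; lra.
- exists l. assert (Hle : forall a b, 0 < a -> a <= b -> RInt f a b <= l).
  { intros a b Ha Hab. apply Hub. now exists a, b. }
  split; [|exact Hle].
  assert (Hmono : forall a b a' b', 0 < a' -> a' <= a -> a <= b -> b <= b' ->
            RInt f a b <= RInt f a' b').
  { intros a b a' b' H0 H1 H2 H3.
    assert (E1 : RInt f a' b' = RInt f a' a + (RInt f a b + RInt f b b')).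
    { rewrite <- (RInt_Chasles (V := R_CompleteNormedModule) f a' a b')
        by (apply ex_RInt_pos_continuous; trivial; lra).
      rewrite <- (RInt_Chasles (V := R_CompleteNormedModule) f a b b')
        by (apply ex_RInt_pos_continuous; trivial; lra).
      reflexivity. }
    assert (Hge : forall u v, 0 < u -> u <= v -> 0 <= RInt f u v).
    { intros u v Hu Huv. apply RInt_ge_0; trivial.
      - now apply ex_RInt_pos_continuous.
      - intros x Hx; apply Hp; lra. }
    assert (G1 := Hge a' a). assert (G2 := Hge b b'). lra. }
  intros P [e He].
  assert (Hex : exists a b, 0 < a /\ a <= b /\ l - e < RInt f a b).
  { destruct (Classical_Prop.classic (exists a b, 0 < a /\ a <= b /\ l - e < RInt f a b))
      as [H|H]; [exact H|exfalso].
    assert (Hn : l <= l - e).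
    { apply Hlub. intros v [a [b [Ha [Hab ->]]]].
      destruct (Rle_or_lt (RInt f a b) (l - e)); trivial.
      exfalso; apply H; now exists a, b. }
    assert (He0 := cond_pos e). lra. }
  destruct Hex as [a [b [Ha [Hab Hl]]]].
  apply Filter_prod with (fun x => 0 < x < a) (fun y => b < y).
  + now apply at_right_0_lt.
  + now exists b.
  + intros x y Hx Hy. simpl.
    exists (RInt f x y). split.
    * apply (RInt_correct (V := R_CompleteNormedModule)). apply ex_RInt_pos_continuous; trivial; lra.
    * apply He. assert (H1 := Hmono a b x y). assert (H2 := Hle x y).
      unfold ball; simpl; unfold AbsRing_ball, abs, minus, plus, opp; simpl.
      apply Rabs_def1; assert (He0 := cond_pos e); lra.
Qed.

(** The norm of the integral of [g - f] is at most that integral itself, which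
    is therefore nonnegative. *)
Lemma is_RInt_gen_pos_le (f g : R -> R) (lf lg : R) :
  (forall t, 0 < t -> f t <= g t) ->
  is_RInt_gen f (at_right 0) (Rbar_locally p_infty) lf ->
  is_RInt_gen g (at_right 0) (Rbar_locally p_infty) lg ->
  lf <= lg.
Proof.
intros Hfg Hf Hg.
assert (Hd := is_RInt_gen_minus _ _ _ _ Hg Hf).
assert (H : norm (minus lg lf) <= minus lg lf).
{ apply (RInt_gen_norm (V := R_CompleteNormedModule)
    (Fa := at_right 0) (Fb := Rbar_locally p_infty)
    (fun y => minus (g y) (f y)) (fun y => minus (g y) (f y))); trivial.
  - apply Filter_prod with (fun x => 0 < x < 1) (fun y => 1 < y).
    + apply at_right_0_lt; lra.
    + now exists 1.
    + intros x y Hx Hy; simpl; lra.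
  - apply Filter_prod with (fun x => 0 < x < 1) (fun y => 1 < y).
    + apply at_right_0_lt; lra.
    + now exists 1.
    + intros x y Hx Hy z Hz; simpl in *.
      assert (f z <= g z) by (apply Hfg; lra).
      unfold norm, minus, plus, opp; simpl; unfold abs; simpl.
      rewrite Rabs_pos_eq; lra. }
unfold norm, minus, plus, opp in H; simpl in H; unfold abs in H; simpl in H.
assert (H' := Rabs_pos (lg + - lf)). lra.
Qed.

(** For [s <= 1] the density is at most [4 t^(s-1) (1+t)^(-1-s)], four times the
    derivative of the bounded function [(t/(1+t))^s / s]. *)
Lemma ex_Gamma (s : R) : 0 < s <= 1 -> exists l, 0 < l /\ is_Gamma s l.
Proof.
intros Hs.
destruct (is_RInt_gen_bounded (euler_density s) (4 / s)) as [l [H1 H2]].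
- intros t Ht. now apply continuous_euler_density.
- intros t Ht. left; apply euler_density_pos.
- intros a b Ha Hab.
  set (G := fun t => 4 / s * Rpower (t / (1 + t)) s).
  set (dG := fun t => 4 * Rpower (t / (1 + t)) (s - 1) / (1 + t) ^ 2).
  assert (HG : forall t, 0 < t -> is_derive G t (dG t)).
  { intros t Ht. unfold G, dG.
    assert (Hq : 0 < t / (1 + t)) by (apply Rdiv_lt_0_compat; lra).
    assert (D := is_derive_comp (fun x => Rpower x s) (fun t => t / (1 + t)) t
      (s * Rpower (t / (1 + t)) (s - 1)) (1 / (1 + t) ^ 2)
      (is_derive_Rpower s _ Hq)).
    assert (D2 : is_derive (fun t => t / (1 + t)) t (1 / (1 + t) ^ 2)).
    { auto_derive; [lra|as_real; field; lra]. }
    specialize (D D2).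
    assert (D3 := is_derive_scal _ _ (4 / s) _ D).
    assert (E : 4 / s * (1 / (1 + t) ^ 2 * (s * Rpower (t / (1 + t)) (s - 1)))
      = 4 * Rpower (t / (1 + t)) (s - 1) / (1 + t) ^ 2) by (field; lra).
    rewrite <- E. exact D3. }
  assert (HdG : forall t, 0 < t -> continuous dG t).
  { intros t Ht. apply (ex_derive_continuous (K := R_AbsRing) (V := R_NormedModule)).
    unfold dG.
    assert (Hq : 0 < t / (1 + t)) by (apply Rdiv_lt_0_compat; lra).
    assert (Hpow : ex_derive (fun t => Rpower (t / (1 + t)) (s - 1)) t).
    { apply (ex_derive_comp (fun x => Rpower x (s - 1)) (fun t => t / (1 + t))).
      - exists ((s - 1) * Rpower (t / (1 + t)) (s - 1 - 1)). now apply is_derive_Rpower.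
      - auto_derive; lra. }
    apply (ex_derive_ext (fun t => Rpower (t / (1 + t)) (s - 1) * (4 / (1 + t) ^ 2))).
    { intros u. as_real; unfold Rdiv; ring. }
    apply (ex_derive_mult (fun t => Rpower (t / (1 + t)) (s - 1)) (fun t => 4 / (1 + t) ^ 2)); trivial.
    auto_derive. nra. }
  assert (HI : is_RInt dG a b (G b - G a)).
  { apply (is_RInt_derive (V := R_CompleteNormedModule) G dG).
    - intros x Hx. rewrite Rmin_left in Hx by lra. apply HG; lra.
    - intros x Hx. rewrite Rmin_left in Hx by lra. apply HdG; lra. }
  apply Rle_trans with (G b - G a).
  + apply (is_RInt_le (euler_density s) dG a b); trivial.
    * apply (RInt_correct (V := R_CompleteNormedModule)).
      apply ex_RInt_pos_continuous; trivial. intros t; apply continuous_euler_density.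
    * intros t Ht. unfold euler_density, dG.
      assert (E1 : Rpower (t / (1 + t)) (s - 1) = Rpower t (s - 1) * Rpower (1 + t) (1 - s)).
      { unfold Rpower. rewrite <- exp_plus. f_equal.
        rewrite ln_div by lra. ring. }
      rewrite E1.
      assert (E2 : 1 <= Rpower (1 + t) (1 - s)).
      { rewrite <- (Rpower_O (1 + t)) at 1 by lra. apply Rle_Rpower; lra. }
      assert (E3 : exp (- t) * (1 + t) ^ 2 <= 4).
      { assert (A := exp_ineq1_le (t / 2)).
        assert (B : exp t = exp (t / 2) * exp (t / 2)) by (rewrite <- exp_plus; f_equal; field).
        assert (C : exp (- t) * exp t = 1) by (rewrite <- exp_plus; rewrite <- exp_0; f_equal; ring).
        assert (D := exp_pos (- t)). nra. }
      assert (E4 : exp (- t) <= 4 / (1 + t) ^ 2).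
      { apply Rmult_le_reg_r with ((1 + t) ^ 2); [nra|].
        unfold Rdiv. rewrite Rmult_assoc, Rinv_l by nra. lra. }
      assert (E5 : 0 < Rpower t (s - 1)) by apply exp_pos.
      assert (E6 : 0 < 4 / (1 + t) ^ 2) by (apply Rdiv_lt_0_compat; nra).
      unfold Rdiv in *. rewrite (Rmult_comm 4), !Rmult_assoc.
      apply Rmult_le_compat_l; [lra|].
      replace (Rpower (1 + t) (1 - s) * (4 * / (1 + t) ^ 2))
        with ((4 * / (1 + t) ^ 2) * Rpower (1 + t) (1 - s)) by ring.
      nra.
  + unfold G.
    assert (A1 : 0 < Rpower (a / (1 + a)) s) by apply exp_pos.
    assert (A2 : Rpower (b / (1 + b)) s <= 1).
    { replace 1 with (Rpower 1 s) at 2.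
      - apply Rle_Rpower_l; [lra|]. split; [apply Rdiv_lt_0_compat; lra|].
        apply Rmult_le_reg_r with (1 + b); [lra|].
        unfold Rdiv; rewrite Rmult_assoc, Rinv_l; lra.
      - unfold Rpower. rewrite ln_1, Rmult_0_r, exp_0. reflexivity. }
    assert (0 < 4 / s) by (apply Rdiv_lt_0_compat; lra). nra.
- exists l. split; trivial.
  apply Rlt_le_trans with (RInt (euler_density s) 1 2); [|apply H2; lra].
  apply RInt_gt_0; [lra| |].
  + intros; apply euler_density_pos.
  + intros x Hx; apply continuous_euler_density; lra.
Qed.

(** From [ln v <= v] at [v = t / (2 s)]; the remaining factor [exp (- t / 2)]
    still tends to 0. *)
Lemma Rpower_exp_bound (s t : R) : 0 < s -> 0 < t ->
  Rpower t s * exp (- t) <= Rpower (2 * s) s / (1 + t / 2).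
Proof.
intros Hs Ht.
assert (H1 : Rpower t s <= Rpower (2 * s) s * exp (t / 2)).
{ unfold Rpower. rewrite <- exp_plus.
  assert (L : ln (t / (2 * s)) <= t / (2 * s)).
  { assert (Hq : 0 < t / (2 * s)) by (apply Rdiv_lt_0_compat; lra).
    assert (A := exp_ineq1_le (ln (t / (2 * s)))). rewrite exp_ln in A by trivial. lra. }
  rewrite ln_div in L by lra.
  assert (E : s * (t / (2 * s)) = t / 2) by (field; lra).
  assert (s * (ln t - ln (2 * s)) <= s * (t / (2 * s))) by (apply Rmult_le_compat_l; lra).
  destruct (Rle_lt_or_eq_dec (s * ln t) (s * ln (2 * s) + t / 2)) as [G|G].
  - lra.
  - left; now apply exp_increasing.
  - right; now rewrite G. }
assert (A := exp_ineq1_le (t / 2)).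
assert (B : exp (- t) * exp (t / 2) * exp (t / 2) = 1).
{ rewrite <- !exp_plus. rewrite <- exp_0. f_equal; field. }
assert (C := exp_pos (- t)).
assert (D : 0 < Rpower (2 * s) s) by apply exp_pos.
apply Rmult_le_reg_r with (1 + t / 2); [lra|].
unfold Rdiv at 2. rewrite (Rmult_assoc (Rpower (2 * s) s)), Rinv_l, Rmult_1_r by lra.
apply Rle_trans with (Rpower (2 * s) s * exp (t / 2) * exp (- t) * exp (t / 2)).
- apply Rmult_le_compat; [| lra | |exact A].
  + left. apply Rmult_lt_0_compat; [apply exp_pos|trivial].
  + apply Rmult_le_compat_r; lra.
- right. rewrite <- (Rmult_1_r (Rpower (2 * s) s)) at 2. rewrite <- B. ring.
Qed.

(** Integration by parts; [t^s e^(-t)] vanishes at both ends. *)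
Lemma is_Gamma_succ (s l : R) : 0 < s -> is_Gamma s l -> is_Gamma (s + 1) (s * l).
Proof.
intros Hs H.
set (h := fun t => Rpower t s * exp (- t)).
assert (Hh : forall t, 0 < t ->
   is_derive h t (s * euler_density s t - euler_density (s + 1) t)).
{ intros t Ht. unfold h, euler_density.
  replace (s + 1 - 1) with s by ring.
  assert (D : is_derive (fun t => exp (- t)) t (- exp (- t))) by (auto_derive; [trivial|as_real; ring]).
  assert (D' := is_derive_mult _ _ _ _ _ (is_derive_Rpower s t Ht) D Rmult_comm).
  unfold plus, mult in D'; simpl in D'.
  replace (s * (Rpower t (s - 1) * exp (- t)) - Rpower t s * exp (- t))
    with (s * Rpower t (s - 1) * exp (- t) + Rpower t s * - exp (- t)) by ring.
  exact D'. }
assert (Hpos : forall a b : R, 0 < a < 1 -> 1 < b -> forall x,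
   Rmin a b <= x <= Rmax a b -> 0 < x).
{ intros a b Ha Hb x Hx. rewrite Rmin_left in Hx; lra. }
assert (HI : is_RInt_gen (Derive h) (at_right 0) (Rbar_locally p_infty) (0 - 0)).
{ apply is_RInt_gen_Derive.
  - apply Filter_prod with (fun x => 0 < x < 1) (fun y => 1 < y).
    + apply at_right_0_lt; lra.
    + now exists 1.
    + intros a b Ha Hb x Hx. eexists. apply Hh. simpl in Hx. now apply (Hpos a b).
  - apply Filter_prod with (fun x => 0 < x < 1) (fun y => 1 < y).
    + apply at_right_0_lt; lra.
    + now exists 1.
    + intros a b Ha Hb x Hx. simpl in Hx.
      assert (Hx0 : 0 < x) by now apply (Hpos a b).
      apply continuous_ext_loc with
        (fun t => minus (scal s (euler_density s t)) (euler_density (s + 1) t)).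
      * exists (mkposreal x Hx0). intros y Hy.
        unfold ball in Hy; simpl in Hy; unfold AbsRing_ball, abs, minus, plus, opp in Hy; simpl in Hy.
        apply Rabs_def2 in Hy.
        symmetry. apply is_derive_unique. apply Hh. lra.
      * apply (continuous_minus (V := R_NormedModule)).
        -- apply (continuous_scal_r (V := R_NormedModule)). now apply continuous_euler_density.
        -- now apply continuous_euler_density.
  - intros P [e He].
    assert (Ha : 0 < Rpower e (/ s)) by apply exp_pos.
    unfold filtermap. eapply filter_imp; [|apply (at_right_0_lt _ Ha)].
    intros t Ht. apply He.
    assert (H1 : Rpower t s < e).
    { replace (pos e) with (Rpower (Rpower e (/ s)) s).
      - apply Rlt_Rpower_l; lra.
      - rewrite Rpower_mult, Rinv_l by lra. apply Rpower_1, cond_pos. }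
    assert (H2 : 0 < Rpower t s) by apply exp_pos.
    assert (H3 := exp_pos (- t)).
    assert (H4 : exp (- t) < 1) by (rewrite <- exp_0; apply exp_increasing; lra).
    unfold ball; simpl; unfold AbsRing_ball, abs, minus, plus, opp; simpl.
    unfold h. rewrite Ropp_0, Rplus_0_r, Rabs_pos_eq by nra. nra.
  - intros P [e He].
    set (K := Rpower (2 * s) s).
    assert (HK : 0 < K) by apply exp_pos.
    assert (He0 := cond_pos e).
    exists (2 * K / e). intros t Ht. apply He.
    assert (HKe : 0 < 2 * K / e) by (apply Rdiv_lt_0_compat; lra).
    assert (B := Rpower_exp_bound s t Hs ltac:(lra)). fold K in B.
    unfold ball; simpl; unfold AbsRing_ball, abs, minus, plus, opp; simpl.
    unfold h. rewrite Ropp_0, Rplus_0_r, Rabs_pos_eq.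
    + apply Rle_lt_trans with (1 := B).
      apply Rmult_lt_reg_r with (1 + t / 2); [lra|].
      unfold Rdiv at 1. rewrite Rmult_assoc, Rinv_l by lra.
      assert (E : e * (2 * K / e) = 2 * K) by (field; lra). nra.
    + left. apply Rmult_lt_0_compat; apply exp_pos. }
rewrite Rminus_0_r in HI.
assert (HJ := is_RInt_gen_minus _ _ _ _ (is_RInt_gen_scal _ s _ H) HI).
replace (s * l) with (minus (scal s l) 0)
  by (unfold minus, plus, opp, scal; simpl; unfold mult; simpl; ring).
eapply is_RInt_gen_ext; [|exact HJ].
apply Filter_prod with (fun x => 0 < x < 1) (fun y => 1 < y).
- apply at_right_0_lt; lra.
- now exists 1.
- intros a b Ha Hb x Hx. simpl in Hx.
  assert (Hx0 : 0 < x) by (apply (Hpos a b); trivial; lra).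
  rewrite (is_derive_unique _ _ _ (Hh x Hx0)).
  unfold minus, plus, opp, scal; simpl; unfold mult; simpl. ring.
Qed.

Lemma is_Gamma_pochhammer (s l : R) (k : nat) :
  0 < s -> is_Gamma s l -> is_Gamma (s + INR k) (pochhammer s k * l).
Proof.
intros Hs H. induction k as [|k IH].
- simpl. now rewrite Rplus_0_r, Rmult_1_l.
- apply is_Gamma_succ in IH.
  + simpl pochhammer. rewrite S_INR.
    replace (s + (INR k + 1)) with (s + INR k + 1) by ring.
    replace (pochhammer s k * (s + INR k) * l) with ((s + INR k) * (pochhammer s k * l)) by ring.
    exact IH.
  + assert (Hk := pos_INR k). lra.
Qed.

(** Concavity of [ln] at the weighted mean of [x] and [1]. *)
Lemma Rpower_bernoulli (x q : R) : 0 < x -> 0 <= q <= 1 -> Rpower x q <= 1 + q * (x - 1).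
Proof.
intros Hx Hq.
assert (Hm : 0 < 1 + q * (x - 1)).
{ destruct (Req_dec q 1) as [->|]; [lra|nra]. }
set (m := 1 + q * (x - 1)) in *.
assert (L : forall u, 0 < u -> ln u <= u - 1).
{ intros u Hu. assert (A := exp_ineq1_le (ln u)). rewrite exp_ln in A by trivial. lra. }
assert (L1 := L (x / m) ltac:(apply Rdiv_lt_0_compat; lra)).
assert (L2 := L (/ m) ltac:(now apply Rinv_0_lt_compat)).
rewrite ln_div in L1 by lra. rewrite ln_Rinv in L2 by lra.
assert (E : q * (x / m - 1) + (1 - q) * (/ m - 1) = 0).
{ unfold m; field. fold m; lra. }
assert (G : q * ln x <= ln m) by nra.
rewrite <- (exp_ln m) by trivial. unfold Rpower.
destruct G as [G|G]; [left; now apply exp_increasing|right; now rewrite G].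
Qed.

(** Wendel's inequality: integrate Bernoulli's bound
    [t^q <= s^q (1 - q + q t / s)] against the density. *)
Lemma is_Gamma_wendel (s q l l' : R) :
  0 < s -> 0 <= q <= 1 -> is_Gamma s l -> is_Gamma (s + q) l' -> l' <= Rpower s q * l.
Proof.
intros Hs Hq H H'.
assert (H1 := is_Gamma_succ s l Hs H).
assert (HJ := is_RInt_gen_scal _ (Rpower s q) _
  (is_RInt_gen_plus _ _ _ _ (is_RInt_gen_scal _ (1 - q) _ H) (is_RInt_gen_scal _ (q / s) _ H1))).
replace (Rpower s q * l) with
  (scal (Rpower s q) (plus (scal (1 - q) l) (scal (q / s) (s * l)))).
2:{ unfold scal, plus; simpl; unfold mult; simpl. field; lra. }
refine (is_RInt_gen_pos_le _ _ _ _ _ H' HJ).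
intros t Ht. unfold scal, plus; simpl; unfold mult; simpl. unfold euler_density.
assert (B := Rpower_bernoulli (t / s) q ltac:(now apply Rdiv_lt_0_compat) Hq).
assert (E1 : Rpower t (s + q - 1) = Rpower t (s - 1) * (Rpower s q * Rpower (t / s) q)).
{ rewrite Rpower_mult_distr by (trivial; now apply Rdiv_lt_0_compat).
  replace (s * (t / s)) with t by (field; lra).
  rewrite <- Rpower_plus. f_equal; ring. }
assert (E2 : Rpower t (s + 1 - 1) = Rpower t (s - 1) * t).
{ rewrite <- (Rpower_1 t Ht) at 3. rewrite <- Rpower_plus. f_equal; ring. }
rewrite E1, E2.
replace (Rpower s q * ((1 - q) * (Rpower t (s - 1) * exp (- t)) +
    q / s * (Rpower t (s - 1) * t * exp (- t)))) with
  (Rpower t (s - 1) * exp (- t) * (Rpower s q * (1 + q * (t / s - 1)))) by (field; lra).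
replace (Rpower t (s - 1) * (Rpower s q * Rpower (t / s) q) * exp (- t)) with
  (Rpower t (s - 1) * exp (- t) * (Rpower s q * Rpower (t / s) q)) by ring.
apply Rmult_le_compat_l.
- left; apply Rmult_lt_0_compat; apply exp_pos.
- apply Rmult_le_compat_l; [left; apply exp_pos|exact B].
Qed.

Lemma pochhammer_pos (a : R) (k : nat) : 0 < a -> 0 < pochhammer a k.
Proof.
intros Ha. induction k as [|k IH]; simpl; [lra|].
apply Rmult_lt_0_compat; trivial. assert (Hk := pos_INR k). lra.
Qed.

Lemma Gamma_third_pos : 0 < Gamma (1 / 3) /\ 0 < Gamma (2 / 3).
Proof.
split; (match goal with |- 0 < Gamma ?s => destruct (ex_Gamma s) as [l [Hl H]] end; [lra|];
  now rewrite (is_Gamma_unique _ _ H)).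
Qed.

Lemma airy_f_coef_pos (k : nat) : 0 < airy_f_coef k.
Proof.
unfold airy_f_coef. apply Rdiv_lt_0_compat; [|apply INR_fact_lt_0].
apply Rmult_lt_0_compat; [apply pow_lt; lra|apply pochhammer_pos; lra].
Qed.

Lemma airy_g_coef_pos (k : nat) : 0 < airy_g_coef k.
Proof.
unfold airy_g_coef. apply Rdiv_lt_0_compat; [|apply INR_fact_lt_0].
apply Rmult_lt_0_compat; [apply pow_lt; lra|apply pochhammer_pos; lra].
Qed.

(** [- Ai'(0) / Ai(0)], that is
    [3^(1/3) Gamma (2/3) / Gamma (1/3)]. *)
Definition airy_ratio : R := airy_c2 / airy_c1.

Lemma airy_c1_pos : 0 < airy_c1.
Proof. apply Rdiv_lt_0_compat; [apply exp_pos|apply Gamma_third_pos]. Qed.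

Lemma airy_ratio_pos : 0 < airy_ratio.
Proof.
apply Rdiv_lt_0_compat; [|apply airy_c1_pos].
apply Rdiv_lt_0_compat; [apply exp_pos|apply Gamma_third_pos].
Qed.

Lemma airy_ratio_cube : airy_ratio ^ 3 * Gamma (1 / 3) ^ 3 = 3 * Gamma (2 / 3) ^ 3.
Proof.
unfold airy_ratio, airy_c1, airy_c2.
destruct Gamma_third_pos as [H1 H2].
assert (H3 : 0 < Rpower 3 (- (2 / 3))) by apply exp_pos.
replace (Rpower 3 (- (1 / 3))) with (Rpower 3 (1 / 3) * Rpower 3 (- (2 / 3)))
  by (rewrite <- Rpower_plus; f_equal; field).
assert (H4 : Rpower 3 (1 / 3) ^ 3 = 3).
{ rewrite <- Rpower_pow by apply exp_pos. rewrite Rpower_mult.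
  replace (1 / 3 * INR 3) with 1 by (simpl; field). apply Rpower_1; lra. }
set (u := Rpower 3 (1 / 3)) in *.
transitivity (u ^ 3 * Gamma (2 / 3) ^ 3); [field; lra|now rewrite H4].
Qed.

Lemma Rpower_third_cube (x : R) (n : nat) : 0 < x -> Rpower x (INR n / 3) ^ 3 = x ^ n.
Proof.
intros Hx. rewrite <- Rpower_pow by apply exp_pos. rewrite Rpower_mult.
replace (INR n / 3 * INR 3) with (INR n) by (simpl; field). now apply Rpower_pow.
Qed.

(** Wendel's inequality between [Gamma (k + 1/3)], [Gamma (k + 2/3)] and
    [Gamma (k + 4/3)], written for the Taylor coefficients.  Cubing clears the
    fractional powers. *)
Lemma airy_coef_ratio_bounds (k : nat) :
  (3 * INR k + 1) ^ 2 * (airy_ratio * airy_g_coef k) ^ 3 <= airy_f_coef k ^ 3 /\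
  airy_f_coef k ^ 3 <= (3 * INR k + 2) ^ 2 * (airy_ratio * airy_g_coef k) ^ 3.
Proof.
destruct (ex_Gamma (1 / 3) ltac:(lra)) as [a [Ha H1]].
destruct (ex_Gamma (2 / 3) ltac:(lra)) as [b [Hb H2]].
assert (Hr := airy_ratio_cube).
rewrite (is_Gamma_unique _ _ H1), (is_Gamma_unique _ _ H2) in Hr.
assert (Hk := pos_INR k).
assert (W1 := is_Gamma_wendel (1 / 3 + INR k) (1 / 3) _ (pochhammer (2 / 3) k * b) ltac:(lra) ltac:(lra)
   (is_Gamma_pochhammer (1 / 3) a k ltac:(lra) H1)).
assert (W2 := is_Gamma_wendel (2 / 3 + INR k) (2 / 3) _ (pochhammer (1 / 3) (S k) * a) ltac:(lra) ltac:(lra)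
   (is_Gamma_pochhammer (2 / 3) b k ltac:(lra) H2)).
replace (1 / 3 + INR k + 1 / 3) with (2 / 3 + INR k) in W1 by field.
specialize (W1 (is_Gamma_pochhammer (2 / 3) b k ltac:(lra) H2)).
replace (2 / 3 + INR k + 2 / 3) with (1 / 3 + INR (S k)) in W2 by (rewrite S_INR; field).
specialize (W2 (is_Gamma_pochhammer (1 / 3) a (S k) ltac:(lra) H1)).
simpl pochhammer in W2.
assert (Ef : airy_f_coef k = 3 ^ k / INR (fact (3 * k)) * pochhammer (1 / 3) k).
{ unfold airy_f_coef. unfold Rdiv; ring. }
assert (Eg : (3 * INR k + 1) * airy_g_coef k = 3 ^ k / INR (fact (3 * k)) * pochhammer (2 / 3) k).
{ unfold airy_g_coef. rewrite Nat.add_1_r, fact_simpl, mult_INR, S_INR, mult_INR.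
  simpl (INR 3). field. split; [apply INR_fact_neq_0|lra]. }
set (A := pochhammer (1 / 3) k) in *. set (B := pochhammer (2 / 3) k) in *.
assert (HA : 0 < A) by (apply pochhammer_pos; lra).
assert (HB : 0 < B) by (apply pochhammer_pos; lra).
set (c := 3 ^ k / INR (fact (3 * k))) in *.
assert (Hc : 0 < c) by (apply Rdiv_lt_0_compat; [apply pow_lt; lra|apply INR_fact_lt_0]).
assert (Cube : forall u v, 0 <= u -> u <= v -> u ^ 3 <= v ^ 3).
{ intros u v Hu Huv. apply pow_incr. lra. }
apply Cube in W1; [|nra]. apply Cube in W2; [|apply Rmult_le_pos; [nra|lra]].
rewrite (Rpow_mult_distr (Rpower _ _)) in W1. rewrite (Rpow_mult_distr (Rpower _ _)) in W2.
replace (1 / 3) with (INR 1 / 3) in W1 at 2 by (simpl; field).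
replace (2 / 3) with (INR 2 / 3) in W2 at 2 by (simpl; field).
rewrite Rpower_third_cube in W1 by lra. rewrite Rpower_third_cube in W2 by lra.
set (K := INR k) in *.
set (g := airy_g_coef k) in *.
assert (Hg : g = c * B / (3 * K + 1)) by (rewrite <- Eg; field; lra).
rewrite Ef, Hg.
assert (E3 : (airy_ratio * (c * B / (3 * K + 1))) ^ 3
   = (c / (3 * K + 1)) ^ 3 * (airy_ratio ^ 3 * a ^ 3) * B ^ 3 / a ^ 3).
{ field. lra. }
rewrite E3, Hr.
assert (Ha3 : 0 < a ^ 3) by now apply pow_lt.
assert (Hc3 : 0 < c ^ 3) by now apply pow_lt.
assert (Hd : 0 < (3 * K + 1) ^ 3) by (apply pow_lt; lra).
split.
- apply Rmult_le_reg_r with (a ^ 3 * (3 * K + 1)); [apply Rmult_lt_0_compat; lra|].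
  replace ((3 * K + 1) ^ 2 * ((c / (3 * K + 1)) ^ 3 * (3 * b ^ 3) * B ^ 3 / a ^ 3) *
      (a ^ 3 * (3 * K + 1))) with (c ^ 3 * (3 * (B * b) ^ 3)) by (field; lra).
  replace ((c * A) ^ 3 * (a ^ 3 * (3 * K + 1))) with
    (c ^ 3 * (3 * ((1 / 3 + K) ^ 1 * (A * a) ^ 3))) by field.
  apply Rmult_le_compat_l; lra.
- apply Rmult_le_reg_r with (a ^ 3 * (3 * K + 1) ^ 3); [apply Rmult_lt_0_compat; lra|].
  replace ((3 * K + 2) ^ 2 * ((c / (3 * K + 1)) ^ 3 * (3 * b ^ 3) * B ^ 3 / a ^ 3) *
      (a ^ 3 * (3 * K + 1) ^ 3)) with (c ^ 3 * (27 * ((2 / 3 + K) ^ 2 * (B * b) ^ 3))) by (field; lra).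
  replace ((c * A) ^ 3 * (a ^ 3 * (3 * K + 1) ^ 3)) with
    (c ^ 3 * (27 * (A * (1 / 3 + K) * a) ^ 3)) by field.
  apply Rmult_le_compat_l; lra.
Qed.

(** * Comparison of the two series on the positive axis *)

Lemma is_series_lin (a b : nat -> R) (u v la lb : R) :
  is_series a la -> is_series b lb ->
  is_series (fun k => u * a k + v * b k) (u * la + v * lb).
Proof.
intros Ha Hb.
exact (is_series_plus _ _ _ _ (is_series_scal u _ _ Ha) (is_series_scal v _ _ Hb)).
Qed.

Lemma is_series_le (a b : nat -> R) (la lb : R) :
  (forall k, a k <= b k) -> is_series a la -> is_series b lb -> la <= lb.
Proof.
intros H Ha Hb.
apply (is_lim_seq_le (sum_n a) (sum_n b) la lb); trivial.
intros n. now apply sum_n_m_le.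
Qed.

Lemma is_series_nonneg (a : nat -> R) (l : R) :
  (forall k, 0 <= a k) -> is_series a l -> 0 <= l.
Proof.
intros H Ha.
replace 0 with (0 * l + 0 * l) by ring.
apply (is_series_le (fun k => 0 * a k + 0 * a k) a); trivial.
- intros k. specialize (H k). lra.
- now apply is_series_lin.
Qed.

Lemma is_series_tail (a : nat -> R) (l : R) :
  is_series a l -> is_series (fun k => a (S k)) (l - a 0%nat).
Proof.
intros H. apply is_series_incr_1.
assert (E : l - a 0%nat + a 0%nat = l) by ring.
change (is_series a (l - a 0%nat + a 0%nat)). now rewrite E.
Qed.

Lemma is_series_of_tail (a : nat -> R) (l : R) :
  is_series (fun k => a (S k)) l -> a 0%nat = 0 -> is_series a l.
Proof.
intros H H0. apply is_series_decr_1. rewrite H0.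
assert (E : l + - 0 = l) by ring.
change (is_series (fun k => a (S k)) (l + - 0)). now rewrite E.
Qed.

Lemma ex_series_nonneg_le (a b : nat -> R) :
  (forall k, 0 <= a k <= b k) -> ex_series b -> ex_series a.
Proof.
intros H Hb. apply (ex_series_le (V := R_CompleteNormedModule) a b); trivial.
intros k. unfold norm; simpl; unfold abs; simpl. rewrite Rabs_pos_eq; apply H.
Qed.

(** With [D k = d k (d k - 1)] the recurrence reads [D (k+1) P (k+1) = x^3 P k],
    so [D] and [D^2] have computable means for the weights [P], and the mean of
    [(D - x^3)^2] is of lower order than [x^6].  The increments satisfy
    [P k - P (k+1) = P (k+1) (D (k+1) - x^3) / x^3]; hence their total variation
    is a small multiple of the sum. *)
Lemma total_variation_small (P d : nat -> R) (x w e : R) :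
  (forall k, 0 <= P k) ->
  d 0%nat * (d 0%nat - 1) = 0 ->
  (forall k, d (S k) = d k + 3) ->
  (forall k, 0 <= d k) ->
  (forall k, P (S k) * (d (S k) * (d (S k) - 1)) = x ^ 3 * P k) ->
  is_series P w -> 1 <= x -> 0 < e ->
  exists v, is_series (fun k => Rabs (P k - P (S k))) v /\ v <= (e / 2 + 9 / (e * x)) * w.
Proof.
intros HP Hd0 HdS Hd Hrec Hw Hx He.
set (D := fun k => d k * (d k - 1)).
assert (S1 : is_series (fun k => P k * D k) (x ^ 3 * w)).
{ apply is_series_of_tail; [|unfold D; rewrite Hd0; ring].
  apply is_series_ext with (fun k => x ^ 3 * P k).
  - intros k. now rewrite <- Hrec.
  - exact (is_series_scal (x ^ 3) _ _ Hw). }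
assert (Ed : ex_series (fun k => P k * d k)).
{ apply ex_series_nonneg_le with (fun k => 1 * (P k * D k) + 1 * P k).
  - intros k. assert (H1 := HP k). assert (H2 := Hd k). split; [nra|].
    unfold D. assert (0 <= P k * (d k - 1) ^ 2) by (apply Rmult_le_pos; [apply HP|apply pow2_ge_0]). nra.
  - eexists. apply is_series_lin; [exact S1|exact Hw]. }
destruct Ed as [m Sd].
assert (Hw0 : 0 <= w) by exact (is_series_nonneg _ _ HP Hw).
assert (Hm : m <= 2 * x ^ 2 * w).
{ assert (H : 2 * x ^ 2 * m + 0 * m <= 1 * (1 * (x ^ 3 * w) + 1 * m) + x ^ 4 * w).
  { eapply is_series_le;
      [|exact (is_series_lin _ _ (2 * x ^ 2) 0 _ _ Sd Sd)
       |exact (is_series_lin _ _ 1 (x ^ 4) _ _ (is_series_lin _ _ 1 1 _ _ S1 Sd) Hw)].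
    intros k; unfold D; cbv beta.
    assert (0 <= P k * (d k - x ^ 2) ^ 2) by (apply Rmult_le_pos; [apply HP|apply pow2_ge_0]).
    nra. }
  assert (X2 : 1 <= x ^ 2) by nra.
  assert (X3 : x ^ 3 <= x ^ 4) by (simpl; nra).
  assert (X4 : x ^ 4 = x ^ 2 * x ^ 2) by ring.
  assert (X3w : x ^ 3 * w <= x ^ 4 * w) by (apply Rmult_le_compat_r; lra).
  destruct (Rle_or_lt m 0) as [Hm0|Hm0].
  - apply Rle_trans with 0; trivial. nra.
  - apply Rmult_le_reg_l with (x ^ 2); [lra|]. nra. }
assert (S2 : is_series (fun k => P k * D k ^ 2) (x ^ 3 * (x ^ 3 * w) + 6 * x ^ 3 * (m + w))).
{ apply is_series_of_tail; [|unfold D; rewrite Hd0; ring].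
  replace (x ^ 3 * (x ^ 3 * w) + 6 * x ^ 3 * (m + w)) with
    (x ^ 3 * (x ^ 3 * w) + 6 * x ^ 3 * (1 * m + 1 * w)) by ring.
  eapply is_series_ext;
    [|exact (is_series_lin _ _ (x ^ 3) (6 * x ^ 3) _ _ S1 (is_series_lin _ _ 1 1 _ _ Sd Hw))].
  intros k; cbv beta. as_real.
  replace (P (S k) * D (S k) ^ 2) with (P (S k) * (d (S k) * (d (S k) - 1)) * D (S k))
    by (unfold D; ring).
  rewrite Hrec. unfold D. rewrite HdS. ring. }
(* [x^3] is the mean of [D], so the terms of order [x^6] cancel. *)
assert (S3 : is_series (fun k => P k * (D k - x ^ 3) ^ 2) (6 * x ^ 3 * (m + w))).
{ replace (6 * x ^ 3 * (m + w)) with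
    (1 * (x ^ 3 * (x ^ 3 * w) + 6 * x ^ 3 * (m + w)) + 1 * (-2 * x ^ 3 * (x ^ 3 * w) + x ^ 6 * w))
    by ring.
  eapply is_series_ext;
    [|exact (is_series_lin _ _ 1 1 _ _ S2 (is_series_lin _ _ (-2 * x ^ 3) (x ^ 6) _ _ S1 Hw))].
  intros k; cbv beta; as_real; ring. }
assert (X3 : 0 < x ^ 3) by (apply pow_lt; lra).
set (c := / (2 * e * x ^ 6)).
assert (X6 : 0 < x ^ 6) by (apply pow_lt; lra).
assert (Hc : 0 < c) by (apply Rinv_0_lt_compat; nra).
(* Young's inequality [|a| <= e / 2 + a^2 / (2 e)] with
   [a = (D - x^3) / x^3]. *)
assert (S4 := is_series_lin _ _ (e / 2) c _ _ Hw S3).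
assert (S5 := is_series_tail _ _ S4). cbv beta in S5.
assert (Hterm : forall k, Rabs (P k - P (S k)) <=
   e / 2 * P (S k) + c * (P (S k) * (D (S k) - x ^ 3) ^ 2)).
{ intros k.
  assert (E : P k - P (S k) = P (S k) * ((D (S k) - x ^ 3) / x ^ 3)).
  { transitivity ((x ^ 3 * P k - x ^ 3 * P (S k)) / x ^ 3); [field; lra|].
    rewrite <- Hrec. unfold D. field; lra. }
  rewrite E, Rabs_mult, (Rabs_pos_eq (P (S k))) by apply HP.
  replace (e / 2 * P (S k) + c * (P (S k) * (D (S k) - x ^ 3) ^ 2)) with
    (P (S k) * (e / 2 + ((D (S k) - x ^ 3) / x ^ 3) ^ 2 / (2 * e)))
    by (unfold c; field; lra).
  apply Rmult_le_compat_l; [apply HP|].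
  set (a := (D (S k) - x ^ 3) / x ^ 3).
  rewrite <- (pow2_abs a).
  assert (Ha := Rabs_pos a). set (b := Rabs a) in *.
  assert (E2 : e / 2 + b ^ 2 / (2 * e) - b = (b - e) ^ 2 / (2 * e)) by (field; lra).
  assert (0 <= (b - e) ^ 2 / (2 * e)) by (apply Rdiv_le_0_compat; first [apply pow2_ge_0|lra]). lra. }
assert (Ev : ex_series (fun k => Rabs (P k - P (S k)))).
{ eapply ex_series_nonneg_le; [|exists (e / 2 * w + c * (6 * x ^ 3 * (m + w)) -
   (e / 2 * P 0%nat + c * (P 0%nat * (D 0%nat - x ^ 3) ^ 2))); exact S5].
  intros k; cbv beta. split; [apply Rabs_pos|apply Hterm]. }
destruct Ev as [v Sv]. exists v. split; trivial.
assert (Hv := is_series_le _ _ _ _ Hterm Sv S5).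
assert (H0 : 0 <= e / 2 * P 0%nat + c * (P 0%nat * (D 0%nat - x ^ 3) ^ 2)).
{ assert (G := HP 0%nat). assert (G2 := pow2_ge_0 (D 0%nat - x ^ 3)).
  apply Rplus_le_le_0_compat; [nra|]. apply Rmult_le_pos; [lra|nra]. }
assert (Hb : c * (6 * x ^ 3 * (m + w)) <= 9 / (e * x) * w).
{ apply Rle_trans with (c * (6 * x ^ 3 * (3 * x ^ 2 * w))).
  - apply Rmult_le_compat_l; [lra|]. apply Rmult_le_compat_l; [lra|].
    assert (w <= x ^ 2 * w) by (rewrite <- (Rmult_1_l w) at 1; apply Rmult_le_compat_r; nra). lra.
  - right. unfold c. field; lra. }
lra.
Qed.

(** Each [P k - Q k] is at most one increment of [P]. *)
Lemma interlaced_sums (P Q : nat -> R) (p q v : R) :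
  (forall k, P k <= Q k \/ P (S k) <= Q k) ->
  is_series P p -> is_series Q q -> is_series (fun k => Rabs (P k - P (S k))) v ->
  p - q <= v.
Proof.
intros H Hp Hq Hv.
assert (A : 1 * p + -1 * q <= v); [|lra].
refine (is_series_le _ _ _ _ _ (is_series_lin _ _ 1 (-1) _ _ Hp Hq) Hv).
intros k; cbv beta.
assert (A1 := Rle_abs (P k - P (S k))). assert (A2 := Rabs_pos (P k - P (S k))).
destruct (H k); lra.
Qed.

(** A term of [ratio * g] divided by the term of [f] with the same index is [x]
    over the coefficient ratio; when this is below 1, the upper cubic bound on
    that ratio makes the next term of [f] small enough. *)
Lemma airy_terms_interlace_f (k : nat) (x : R) : 0 < x ->
  let P k := airy_f_coef k * x ^ (3 * k) in
  P k <= airy_ratio * (airy_g_coef k * x ^ (3 * k + 1)) \/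
  P (S k) <= airy_ratio * (airy_g_coef k * x ^ (3 * k + 1)).
Proof.
intros Hx P; unfold P; clear P.
destruct (airy_coef_ratio_bounds k) as [_ Hb].
assert (Hrec := airy_f_coef_rec k).
assert (Hk := pos_INR k).
assert (HB : 0 < airy_ratio * airy_g_coef k)
  by (apply Rmult_lt_0_compat; [apply airy_ratio_pos|apply airy_g_coef_pos]).
assert (HA := airy_f_coef_pos k).
replace (airy_ratio * (airy_g_coef k * x ^ (3 * k + 1)))
  with (airy_ratio * airy_g_coef k * (x * x ^ (3 * k))) by (rewrite pow_add; ring).
replace (x ^ (3 * S k)) with (x ^ 3 * x ^ (3 * k)) by (rewrite <- pow_add; f_equal; lia).
assert (Hy : 0 < x ^ (3 * k)) by now apply pow_lt.
set (y := x ^ (3 * k)) in *.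
set (A := airy_f_coef k) in *. set (B := airy_ratio * airy_g_coef k) in *.
set (A1 := airy_f_coef (S k)) in *. set (K := INR k) in *.
destruct (Rle_or_lt A (B * x)) as [H|H]; [left; nra|right].
assert (H1 : (B * x) ^ 2 * A <= A ^ 3).
{ replace (A ^ 3) with (A ^ 2 * A) by ring. apply Rmult_le_compat_r; [lra|].
  apply pow_incr. split; [left; now apply Rmult_lt_0_compat|lra]. }
assert (H2 : x ^ 2 * A <= (3 * K + 2) ^ 2 * B).
{ apply Rmult_le_reg_l with (B ^ 2); [now apply pow_lt|].
  replace (B ^ 2 * (x ^ 2 * A)) with ((B * x) ^ 2 * A) by ring.
  replace (B ^ 2 * ((3 * K + 2) ^ 2 * B)) with ((3 * K + 2) ^ 2 * B ^ 3) by ring. lra. }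
assert (H3 : x ^ 2 * A1 <= B).
{ apply Rmult_le_reg_l with ((3 * K + 3) * (3 * K + 2)); [nra|].
  replace ((3 * K + 3) * (3 * K + 2) * (x ^ 2 * A1)) with (x ^ 2 * A) by (rewrite <- Hrec; ring).
  apply Rle_trans with (1 := H2). apply Rmult_le_compat_r; nra. }
replace (A1 * (x ^ 3 * y)) with (x ^ 2 * A1 * (x * y)) by ring.
apply Rmult_le_compat_r; [left; now apply Rmult_lt_0_compat|exact H3].
Qed.

(** The same with the roles exchanged and the lower bound on the coefficient
    ratio. *)
Lemma airy_terms_interlace_g (k : nat) (x : R) : 0 < x ->
  let Q k := airy_ratio * (airy_g_coef k * x ^ (3 * k + 1)) in
  Q k <= airy_f_coef (S k) * x ^ (3 * S k) \/
  Q (S k) <= airy_f_coef (S k) * x ^ (3 * S k).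
Proof.
intros Hx Q; unfold Q; clear Q.
destruct (airy_coef_ratio_bounds (S k)) as [Hb _].
assert (Hrec := airy_g_coef_rec k).
assert (Hk := pos_INR k).
rewrite S_INR in Hb.
assert (HB : 0 < airy_ratio * airy_g_coef (S k))
  by (apply Rmult_lt_0_compat; [apply airy_ratio_pos|apply airy_g_coef_pos]).
assert (HA := airy_f_coef_pos (S k)).
replace (x ^ (3 * k + 1)) with (x * x ^ (3 * k)) by (rewrite pow_add; ring).
replace (x ^ (3 * S k + 1)) with (x ^ 4 * x ^ (3 * k)) by (rewrite <- pow_add; f_equal; lia).
replace (x ^ (3 * S k)) with (x ^ 3 * x ^ (3 * k)) by (rewrite <- pow_add; f_equal; lia).
assert (Hy : 0 < x ^ (3 * k)) by now apply pow_lt.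
rewrite <- Hrec.
set (y := x ^ (3 * k)) in *.
set (K := INR k) in *.
replace (airy_ratio * ((3 * K + 4) * (3 * K + 3) * airy_g_coef (S k) * (x * y))) with
  ((3 * K + 4) * (3 * K + 3) * (airy_ratio * airy_g_coef (S k)) * (x * y)) by ring.
replace (airy_ratio * (airy_g_coef (S k) * (x ^ 4 * y))) with
  (airy_ratio * airy_g_coef (S k) * x * (x ^ 3 * y)) by ring.
set (B := airy_ratio * airy_g_coef (S k)) in *.
set (A := airy_f_coef (S k)) in *.
assert (Hx3 : 0 < x ^ 3) by now apply pow_lt.
destruct (Rle_or_lt (B * x) A) as [H|H]; [right|left].
{ apply Rmult_le_compat_r; trivial. left; now apply Rmult_lt_0_compat. }
assert (H1 : A ^ 3 <= (B * x) ^ 2 * A).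
{ replace (A ^ 3) with (A ^ 2 * A) by ring. apply Rmult_le_compat_r; [lra|].
  apply pow_incr. lra. }
assert (H2 : (3 * K + 4) ^ 2 * B <= x ^ 2 * A).
{ apply Rmult_le_reg_l with (B ^ 2); [now apply pow_lt|].
  replace (B ^ 2 * (x ^ 2 * A)) with ((B * x) ^ 2 * A) by ring.
  replace (B ^ 2 * ((3 * K + 4) ^ 2 * B)) with ((3 * (K + 1) + 1) ^ 2 * B ^ 3) by ring. lra. }
assert (H3 : (3 * K + 4) * (3 * K + 3) * B <= x ^ 2 * A).
{ apply Rle_trans with (2 := H2). apply Rmult_le_compat_r; nra. }
replace (A * (x ^ 3 * y)) with (x ^ 2 * A * (x * y)) by ring.
apply Rmult_le_compat_r; [left; now apply Rmult_lt_0_compat|exact H3].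
Qed.

Lemma airy_f_g_asymptotic (e : R) : 0 < e ->
  exists X, 1 <= X /\ forall x p q, X <= x ->
  is_series (fun k => airy_f_coef k * x ^ (3 * k)) p ->
  is_series (fun k => airy_g_coef k * x ^ (3 * k + 1)) q ->
  p - airy_ratio * q <= e * p /\ airy_ratio * q - p <= e * (airy_ratio * q).
Proof.
intros He. exists (1 + 18 / e ^ 2).
assert (He2 : 0 < 18 / e ^ 2) by (apply Rdiv_lt_0_compat; nra).
split; [lra|]. intros x p q HX Hp Hq.
assert (Hx : 0 < x) by lra.
assert (Hr := airy_ratio_pos).
assert (Hq' : is_series (fun k => airy_ratio * (airy_g_coef k * x ^ (3 * k + 1))) (airy_ratio * q))
  by exact (is_series_scal airy_ratio _ _ Hq).
assert (Hsmall : e / 2 + 9 / (e * x) <= e).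
{ assert (9 / (e * x) <= e / 2); [|lra].
  apply Rmult_le_reg_r with (e * x); [nra|].
  replace (9 / (e * x) * (e * x)) with 9 by (field; lra).
  assert (E : e ^ 2 * (18 / e ^ 2) = 18) by (field; lra). nra. }
destruct (total_variation_small (fun k => airy_f_coef k * x ^ (3 * k))
  (fun k => 3 * INR k) x p e) as [v [Hv Hvb]]; trivial; try lra.
{ intros k. left. apply Rmult_lt_0_compat; [apply airy_f_coef_pos|now apply pow_lt]. }
{ simpl; ring. }
{ intros k; rewrite S_INR; ring. }
{ intros k; assert (H := pos_INR k); lra. }
{ intros k. rewrite <- (airy_f_coef_rec k), S_INR.
  replace (x ^ (3 * S k)) with (x ^ 3 * x ^ (3 * k)) by (rewrite <- pow_add; f_equal; lia). ring. }
destruct (total_variation_small (fun k => airy_ratio * (airy_g_coef k * x ^ (3 * k + 1)))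
  (fun k => 3 * INR k + 1) x (airy_ratio * q) e) as [v' [Hv' Hvb']]; trivial; try lra.
{ intros k. left. apply Rmult_lt_0_compat; trivial.
  apply Rmult_lt_0_compat; [apply airy_g_coef_pos|now apply pow_lt]. }
{ simpl; ring. }
{ intros k; rewrite S_INR; ring. }
{ intros k; assert (H := pos_INR k); lra. }
{ intros k. rewrite <- (airy_g_coef_rec k), S_INR.
  replace (x ^ (3 * S k + 1)) with (x ^ 3 * x ^ (3 * k + 1)) by (rewrite <- pow_add; f_equal; lia). ring. }
assert (Hp0 : 0 <= p).
{ refine (is_series_nonneg _ _ _ Hp). intros k. left.
  apply Rmult_lt_0_compat; [apply airy_f_coef_pos|now apply pow_lt]. }
assert (Hq0 : 0 <= q).
{ refine (is_series_nonneg _ _ _ Hq). intros k. left.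
  apply Rmult_lt_0_compat; [apply airy_g_coef_pos|now apply pow_lt]. }
split.
- assert (A := interlaced_sums _ _ _ _ _ (fun k => airy_terms_interlace_f k x Hx) Hp Hq' Hv).
  assert ((e / 2 + 9 / (e * x)) * p <= e * p) by (apply Rmult_le_compat_r; lra). lra.
- assert (A := interlaced_sums _ (fun k => airy_f_coef (S k) * x ^ (3 * S k)) _ _ _
    (fun k => airy_terms_interlace_g k x Hx) Hq' (is_series_tail _ _ Hp) Hv').
  cbv beta in A.
  assert (0 < airy_f_coef 0 * x ^ (3 * 0)) by (apply Rmult_lt_0_compat; [apply airy_f_coef_pos|now apply pow_lt]).
  assert (0 <= airy_ratio * q) by nra.
  assert ((e / 2 + 9 / (e * x)) * (airy_ratio * q) <= e * (airy_ratio * q)) by (apply Rmult_le_compat_r; lra).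
  lra.
Qed.

(** * Termwise differentiation of entire series *)

(** A quadratic remainder is what a termwise estimate of a power series gives,
    and it passes to real and imaginary parts along any line. *)
Definition entire_deriv (W W1 : C -> C) : Prop :=
  forall z, exists K, forall h : C, Cmod h <= 1 ->
    Cmod (W (z + h) - W z - h * W1 z)%C <= K * Cmod h ^ 2.

Lemma entire_deriv_lin (A A1 B B1 : C -> C) (k : C) :
  entire_deriv A A1 -> entire_deriv B B1 ->
  entire_deriv (fun z => A z + k * B z)%C (fun z => A1 z + k * B1 z)%C.
Proof.
intros HA HB z.
destruct (HA z) as [K1 H1]. destruct (HB z) as [K2 H2].
exists (K1 + Cmod k * K2). intros h Hh.
replace (A (z + h) + k * B (z + h) - (A z + k * B z) - h * (A1 z + k * B1 z))%C with
  ((A (z + h) - A z - h * A1 z) + k * (B (z + h) - B z - h * B1 z))%C by ring.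
eapply Rle_trans; [apply Cmod_triangle|]. rewrite Cmod_mult.
assert (E1 := H1 h Hh). assert (E2 := H2 h Hh). assert (E3 := Cmod_ge_0 k).
assert (Cmod k * Cmod (B (z + h) - B z - h * B1 z)%C <= Cmod k * (K2 * Cmod h ^ 2))
  by (now apply Rmult_le_compat_l).
lra.
Qed.

Lemma entire_deriv_ext (A A1 B B1 : C -> C) :
  (forall z, A z = B z) -> (forall z, A1 z = B1 z) -> entire_deriv A A1 -> entire_deriv B B1.
Proof.
intros E E1 H z. destruct (H z) as [K HK]. exists K. intros h Hh.
rewrite <- !E, <- E1. now apply HK.
Qed.

Lemma is_derive_of_quadratic_bound (F : R -> R) (t l K r : R) :
  0 < r -> (forall h, Rabs h <= r -> Rabs (F (t + h) - F t - h * l) <= K * h ^ 2) ->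
  is_derive F t l.
Proof.
intros Hr H. apply is_derive_Reals. intros e He.
assert (HK : 0 <= K).
{ assert (A := H r ltac:(rewrite Rabs_pos_eq; lra)).
  assert (B := Rabs_pos (F (t + r) - F t - r * l)).
  assert (0 < r ^ 2) by nra. nra. }
assert (Hd : 0 < Rmin r (e / (K + 1))).
{ apply Rmin_pos; trivial. apply Rdiv_lt_0_compat; lra. }
exists (mkposreal _ Hd). intros h Hh0 Hh. simpl in Hh.
assert (Hh1 := Rmin_l r (e / (K + 1))). assert (Hh2 := Rmin_r r (e / (K + 1))).
assert (A := H h ltac:(lra)).
replace ((F (t + h) - F t) / h - l) with ((F (t + h) - F t - h * l) / h) by (field; trivial).
assert (Hp : 0 < Rabs h) by now apply Rabs_pos_lt.
unfold Rdiv. rewrite Rabs_mult, Rabs_inv.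
apply Rmult_lt_reg_r with (Rabs h); trivial.
rewrite Rmult_assoc, Rinv_l, Rmult_1_r by lra.
rewrite <- pow2_abs in A.
assert (B : Rabs h * (K + 1) < e).
{ apply Rlt_le_trans with (e / (K + 1) * (K + 1)).
  - apply Rmult_lt_compat_r; lra.
  - right; field; lra. }
nra.
Qed.

Lemma im_le_Cmod (c : C) : Rabs (Im c) <= Cmod c.
Proof. eapply Rle_trans; [apply Rmax_r|apply Rmax_Cmod]. Qed.

Lemma entire_deriv_line (W W1 : C -> C) (z d : C) (t : R) :
  entire_deriv W W1 ->
  is_derive (fun s : R => Re (W (z + RtoC s * d)%C)) t (Re (d * W1 (z + RtoC t * d)%C)%C) /\
  is_derive (fun s : R => Im (W (z + RtoC s * d)%C)) t (Im (d * W1 (z + RtoC t * d)%C)%C).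
Proof.
intros H. destruct (H (z + RtoC t * d)%C) as [K HK].
assert (Hd := Cmod_ge_0 d).
assert (Hr : 0 < / (Cmod d + 1)) by (apply Rinv_0_lt_compat; lra).
assert (Hmain : forall h : R, Rabs h <= / (Cmod d + 1) ->
  Cmod (W (z + RtoC (t + h) * d) - W (z + RtoC t * d) - RtoC h * (d * W1 (z + RtoC t * d)))%C
    <= K * Cmod d ^ 2 * h ^ 2).
{ intros h Hh.
  assert (E : Cmod (RtoC h * d) = Rabs h * Cmod d) by (rewrite Cmod_mult, Cmod_R; reflexivity).
  assert (G := HK (RtoC h * d)%C). rewrite E in G.
  replace (z + RtoC (t + h) * d)%C with (z + RtoC t * d + RtoC h * d)%C
    by (rewrite RtoC_plus; ring).
  replace (RtoC h * (d * W1 (z + RtoC t * d)))%C with (RtoC h * d * W1 (z + RtoC t * d))%C by ring.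
  replace (K * Cmod d ^ 2 * h ^ 2) with (K * (Rabs h * Cmod d) ^ 2)
    by (rewrite Rpow_mult_distr, pow2_abs; ring).
  apply G.
  apply Rle_trans with (/ (Cmod d + 1) * (Cmod d + 1)).
  - apply Rmult_le_compat; try lra. apply Rabs_pos.
  - right; field; lra. }
split; apply (is_derive_of_quadratic_bound _ _ _ (K * Cmod d ^ 2) _ Hr);
  intros h Hh; eapply Rle_trans; [|exact (Hmain h Hh)| |exact (Hmain h Hh)].
- eapply Rle_trans; [|apply re_le_Cmod]. right. f_equal. unfold Re, Im. simpl. ring.
- eapply Rle_trans; [|apply im_le_Cmod]. right. f_equal. unfold Re, Im. simpl. ring.
Qed.

Lemma is_series_Re (a : nat -> C) (l : C) :
  is_series a l -> is_series (fun k => Re (a k)) (Re l).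
Proof.
intros H. unfold is_series.
apply filterlim_ext with (fun n => Re (sum_n a n)).
- intros n. induction n as [|n IH].
  + now rewrite !sum_O.
  + rewrite !sum_Sn, <- IH. reflexivity.
- eapply filterlim_comp; [exact H|].
  intros P [e He]; exists e. destruct l as [x y]. intros [u' v'] [B _]. apply He, B.
Qed.

Lemma Cmod_is_series_le (a : nat -> C) (b : nat -> R) (l : C) (lb : R) :
  (forall k, Cmod (a k) <= b k) -> is_series a l -> is_series b lb -> Cmod l <= lb.
Proof.
intros H Ha Hb.
apply (is_lim_seq_le (fun n => Cmod (sum_n a n)) (sum_n b) (Cmod l) lb).
- intros n. induction n as [|n IH].
  + rewrite !sum_O. apply H.
  + rewrite !sum_Sn. eapply Rle_trans; [apply Cmod_triangle|].
    apply Rplus_le_compat; trivial.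
- eapply filterlim_comp; [exact Ha|].
  exact (filterlim_norm (V := C_NormedModule) l).
- exact Hb.
Qed.

(** Induction on [n]: multiplying the remainder for [n] by [z + h] leaves the
    remainder for [n + 1] up to [n h^2 z^(n-1)]. *)
Lemma pow_remainder_bound (z h : C) (r : R) (n : nat) :
  1 <= r -> Cmod z <= r -> Cmod (z + h) <= r ->
  Cmod ((z + h) ^ n - z ^ n - h * (RtoC (INR n) * z ^ (pred n)))%C
    <= INR n ^ 2 * Cmod h ^ 2 * r ^ n.
Proof.
intros Hr Hz Hzh. induction n as [|n IH].
- replace ((z + h) ^ 0 - z ^ 0 - h * (RtoC (INR 0) * z ^ (pred 0)))%C with (RtoC 0).
  + rewrite Cmod_0. simpl. lra.
  + simpl. ring.
- replace ((z + h) ^ S n - z ^ S n - h * (RtoC (INR (S n)) * z ^ pred (S n)))%C with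
   ((z + h) * ((z + h) ^ n - z ^ n - h * (RtoC (INR n) * z ^ (pred n))) +
     RtoC (INR n) * (h ^ 2 * z ^ pred n))%C.
  + eapply Rle_trans; [apply Cmod_triangle|].
    rewrite !Cmod_mult, !Cmod_pow, Cmod_R, (Rabs_pos_eq _ (pos_INR n)).
    set (u := Cmod ((z + h) ^ n - z ^ n - h * (RtoC (INR n) * z ^ pred n))) in *.
    assert (Hu : 0 <= u) by apply Cmod_ge_0.
    assert (Hn := pos_INR n).
    assert (A : Cmod z ^ pred n <= r ^ n).
    { apply Rle_trans with (r ^ pred n).
      - apply pow_incr. split; [apply Cmod_ge_0|trivial].
      - apply Rle_pow; trivial; lia. }
    assert (Hrn : 0 < r ^ n) by (apply pow_lt; lra).
    assert (Hh := pow2_ge_0 (Cmod h)).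
    set (H2 := Cmod h ^ 2) in *.
    apply Rle_trans with (r * (INR n ^ 2 * H2 * r ^ n) + INR n * (H2 * r ^ n)).
    * apply Rplus_le_compat.
      -- apply Rmult_le_compat; trivial. apply Cmod_ge_0.
      -- apply Rmult_le_compat_l; trivial. now apply Rmult_le_compat_l.
    * rewrite S_INR. simpl (r ^ S n).
      assert (Hm : 0 <= H2 * r ^ n) by (apply Rmult_le_pos; lra).
      set (m := H2 * r ^ n) in *.
      replace (r * (INR n ^ 2 * H2 * r ^ n) + INR n * m) with ((r * INR n ^ 2 + INR n) * m)
        by (unfold m; ring).
      replace ((INR n + 1) ^ 2 * H2 * (r * r ^ n)) with (((INR n + 1) ^ 2 * r) * m)
        by (unfold m; ring).
      apply Rmult_le_compat_r; trivial. nra.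
  + rewrite S_INR, RtoC_plus. simpl pred. destruct n as [|n].
    * simpl. ring.
    * simpl pred. simpl Cpow. ring.
Qed.

Lemma INR_le_pow2 (n : nat) : INR n <= 2 ^ n.
Proof.
induction n as [|n IH]; [simpl; lra|]. rewrite S_INR. simpl.
assert (1 <= 2 ^ n) by (apply pow_R1_Rle; lra). lra.
Qed.

(** Absolute convergence of [sum c k z^(d k)] in the whole plane. *)
Definition entire_coef (c : nat -> R) (d : nat -> nat) : Prop :=
  forall r, 1 <= r -> ex_series (fun k => Rabs (c k) * r ^ d k).

Definition power_sum (c : nat -> R) (d : nat -> nat) (z : C) : C :=
  CSeries (fun k => RtoC (c k) * z ^ d k)%C.

Lemma is_series_power_sum (c : nat -> R) (d : nat -> nat) (z : C) :
  entire_coef c d -> is_series (fun k => RtoC (c k) * z ^ d k)%C (power_sum c d z).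
Proof.
intros H.
assert (Ex : ex_series (fun k => RtoC (c k) * z ^ d k)%C).
{ apply (ex_series_le (V := C_CompleteNormedModule) _
    (fun k => Rabs (c k) * (Cmod z + 1) ^ d k)).
  - intros k. change (norm (RtoC (c k) * z ^ d k)%C) with (Cmod (RtoC (c k) * z ^ d k)%C).
    rewrite Cmod_mult, Cmod_R, Cmod_pow. apply Rmult_le_compat_l; [apply Rabs_pos|].
    apply pow_incr. assert (A := Cmod_ge_0 z). lra.
  - apply H. assert (A := Cmod_ge_0 z). lra. }
destruct Ex as [l Hl]. unfold power_sum. now rewrite (CSeries_correct _ _ Hl).
Qed.

Lemma power_sum_Im (c : nat -> R) (d : nat -> nat) (x : R) : Im (power_sum c d (RtoC x)) = 0.
Proof.
change (Series (fun k => Im (RtoC (c k) * RtoC x ^ d k)%C) = 0).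
rewrite (Series_ext _ (fun k => 0 * 0)), Series_scal_l; [ring|].
intros k. rewrite <- RtoC_pow, <- RtoC_mult. simpl. ring.
Qed.

Definition deriv_coef (c : nat -> R) (d : nat -> nat) (k : nat) : R := c k * INR (d k).

(** The factor [d k] is absorbed by doubling the radius. *)
Lemma entire_coef_deriv (c : nat -> R) (d : nat -> nat) :
  entire_coef c d -> entire_coef (deriv_coef c d) (fun k => pred (d k)).
Proof.
intros H r Hr.
apply ex_series_nonneg_le with (fun k => Rabs (c k) * (2 * r) ^ d k); [|apply H; lra].
intros k. unfold deriv_coef.
rewrite Rabs_mult, (Rabs_pos_eq _ (pos_INR _)).
assert (A := Rabs_pos (c k)). assert (B := pos_INR (d k)).
assert (D := INR_le_pow2 (d k)).
assert (E : r ^ pred (d k) <= r ^ d k) by (apply Rle_pow; trivial; lia).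
assert (F : 0 < r ^ pred (d k)) by (apply pow_lt; lra).
split; [apply Rmult_le_pos; [apply Rmult_le_pos|]; lra|].
rewrite Rpow_mult_distr, Rmult_assoc. apply Rmult_le_compat_l; trivial.
apply Rmult_le_compat; lra.
Qed.

Lemma is_series_C_lin (a b : nat -> C) (u la lb : C) :
  is_series a la -> is_series b lb ->
  is_series (fun k => a k + u * b k)%C (la + u * lb)%C.
Proof.
intros Ha Hb.
exact (is_series_plus _ _ _ _ Ha (is_series_scal u _ _ Hb)).
Qed.

Lemma power_sum_deriv (c : nat -> R) (d : nat -> nat) :
  entire_coef c d ->
  entire_deriv (power_sum c d) (power_sum (deriv_coef c d) (fun k => pred (d k))).
Proof.
intros H z.
assert (Hz := Cmod_ge_0 z).
set (r := Cmod z + 1).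
destruct (H (4 * r)) as [K HK]; [unfold r; lra|].
exists K. intros h Hh.
assert (S1 := is_series_power_sum c d (z + h)%C H).
assert (S2 := is_series_power_sum c d z H).
assert (S3 := is_series_power_sum _ _ z (entire_coef_deriv c d H)).
assert (S4 := is_series_C_lin _ _ (- h)%C _ _ (is_series_C_lin _ _ (- (1))%C _ _ S1 S2) S3).
assert (S5 := is_series_scal (Cmod h ^ 2) _ _ HK).
match type of S4 with is_series _ ?l => replace (power_sum c d (z + h) - power_sum c d z -
   h * power_sum (deriv_coef c d) (fun k => pred (d k)) z)%C with l by ring end.
rewrite Rmult_comm.
refine (Cmod_is_series_le _ _ _ _ _ S4 S5).
intros k; cbv beta. unfold deriv_coef.
change (scal (Cmod h ^ 2) (Rabs (c k) * (4 * r) ^ d k)) with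
  (Cmod h ^ 2 * (Rabs (c k) * (4 * r) ^ d k)).
set (n := d k).
replace (RtoC (c k) * (z + h) ^ n + - (1) * (RtoC (c k) * z ^ n) +
    - h * (RtoC (c k * INR n) * z ^ pred n))%C with
  (RtoC (c k) * ((z + h) ^ n - z ^ n - h * (RtoC (INR n) * z ^ pred n)))%C
  by (rewrite RtoC_mult; ring).
rewrite Cmod_mult, Cmod_R.
assert (B := pow_remainder_bound z h r n ltac:(unfold r; lra) ltac:(unfold r; lra)
  ltac:(unfold r; eapply Rle_trans; [apply Cmod_triangle|lra])).
replace (Cmod h ^ 2 * (Rabs (c k) * (4 * r) ^ n)) with
  (Rabs (c k) * (4 ^ n * Cmod h ^ 2 * r ^ n)) by (rewrite Rpow_mult_distr; ring).
apply Rmult_le_compat_l; [apply Rabs_pos|].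
eapply Rle_trans; [exact B|].
apply Rmult_le_compat_r; [apply pow_le; unfold r; lra|].
apply Rmult_le_compat_r; [apply pow2_ge_0|].
replace 4 with (2 * 2) by ring. rewrite Rpow_mult_distr.
assert (A := INR_le_pow2 n). assert (A' := pos_INR n). simpl. nra.
Qed.

Lemma power_sum_ext (c c' : nat -> R) (d d' : nat -> nat) (z : C) :
  (forall k, RtoC (c k) * z ^ d k = RtoC (c' k) * z ^ d' k)%C ->
  power_sum c d z = power_sum c' d' z.
Proof.
intros H. unfold power_sum, CSeries.
f_equal; apply Series_ext; intros k; now rewrite H.
Qed.

(** * The Airy equation *)

Definition airy_solution (W W1 : C -> C) : Prop :=
  entire_deriv W W1 /\ entire_deriv W1 (fun z => z * W z)%C.

Lemma airy_solution_lin (A A1 B B1 : C -> C) (k : C) :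
  airy_solution A A1 -> airy_solution B B1 ->
  airy_solution (fun z => A z + k * B z)%C (fun z => A1 z + k * B1 z)%C.
Proof.
intros [HA HA1] [HB HB1]. split.
- now apply entire_deriv_lin.
- eapply entire_deriv_ext; [| |exact (entire_deriv_lin _ _ _ _ k HA1 HB1)]; intros z; simpl; ring.
Qed.

(** Differentiating twice shifts the series by one index, since consecutive
    exponents differ by 3; the term of index 0 dies because [j (j - 1) = 0]. *)
Lemma power_sum_airy_solution (c : nat -> R) (j : nat) :
  let d k := (3 * k + j)%nat in
  entire_coef c d -> (j <= 1)%nat ->
  (forall k, c (S k) * (INR (d (S k)) * INR (pred (d (S k)))) = c k) ->
  airy_solution (power_sum c d) (power_sum (deriv_coef c d) (fun k => pred (d k))).
Proof.
intros d H Hj Hrec.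
assert (H1 := entire_coef_deriv c d H).
split; [now apply power_sum_deriv|].
eapply entire_deriv_ext; [| |exact (power_sum_deriv _ _ H1)]; [reflexivity|].
intros z. set (e := fun k => pred (pred (d k))).
assert (S0 := is_series_power_sum c d z H).
assert (S3 := is_series_scal z _ _ S0).
assert (S4 : is_series (fun k => RtoC (deriv_coef (deriv_coef c d) (fun k => pred (d k)) k) * z ^ e k)%C
   (z * power_sum c d z)%C).
{ apply is_series_decr_1.
  assert (E0 : deriv_coef (deriv_coef c d) (fun k => pred (d k)) 0 = 0).
  { unfold deriv_coef, d. destruct j as [|[|j]]; [simpl; ring|simpl; ring|lia]. }
  rewrite E0.
  assert (E : (z * power_sum c d z + - (RtoC 0 * z ^ e 0%nat))%C = (z * power_sum c d z)%C) by ring.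
  match goal with |- is_series ?a _ =>
    change (is_series a (z * power_sum c d z + - (RtoC 0 * z ^ e 0%nat))%C) end.
  rewrite E.
  eapply is_series_ext; [|exact S3].
  intros k.
  change (z * (RtoC (c k) * z ^ d k) =
    RtoC (deriv_coef (deriv_coef c d) (fun k => pred (d k)) (S k)) * z ^ e (S k))%C.
  unfold deriv_coef. rewrite Rmult_assoc, Hrec.
  replace (e (S k)) with (S (d k)) by (unfold e, d; lia).
  simpl. ring. }
rewrite <- (CSeries_correct _ _ S4). reflexivity.
Qed.

(** * Recessive solutions on the positive axis *)

Definition real_airy_solution (u u1 : R -> R) : Prop :=
  forall x, is_derive u x (u1 x) /\ is_derive u1 x (x * u x).

Lemma real_airy_solution_lin (u u1 v v1 : R -> R) (c : R) :
  real_airy_solution u u1 -> real_airy_solution v v1 ->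
  real_airy_solution (fun x => u x + c * v x) (fun x => u1 x + c * v1 x).
Proof.
intros Hu Hv x. destruct (Hu x) as [A A1]. destruct (Hv x) as [B B1].
split.
- exact (is_derive_plus _ _ _ _ _ A (is_derive_scal _ _ c _ B)).
- replace (x * (u x + c * v x)) with (x * u x + c * (x * v x)) by ring.
  exact (is_derive_plus _ _ _ _ _ A1 (is_derive_scal _ _ c _ B1)).
Qed.

Lemma is_derive_prod (F G : R -> R) (t f g : R) :
  is_derive F t f -> is_derive G t g -> is_derive (fun x => F x * G x) t (f * G t + F t * g).
Proof. intros HF HG. exact (is_derive_mult _ _ _ _ _ HF HG Rmult_comm). Qed.

Lemma nonincr_of_derive (f df : R -> R) (a b : R) :
  a <= b ->
  (forall x, a <= x <= b -> is_derive f x (df x)) ->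
  (forall x, a <= x <= b -> df x <= 0) ->
  f b <= f a.
Proof.
intros Hab Hd Hn.
assert (H : - f a <= - f b); [|lra].
apply (nondecr_of_derive (fun x => - f x) (fun x => - df x) a b Hab).
- intros x Hx. exact (is_derive_opp f x _ (Hd x Hx)).
- intros x Hx. specialize (Hn x Hx). lra.
Qed.

Lemma real_airy_prod_derive (u u1 : R -> R) (x : R) :
  real_airy_solution u u1 ->
  is_derive (fun x => u x * u1 x) x (u1 x * u1 x + u x * (x * u x)).
Proof. intros H. destruct (H x). now apply is_derive_prod. Qed.

(** [(u u')' = u'^2 + x u^2]. *)
Lemma real_airy_prod_nondecr (u u1 : R -> R) (a b : R) :
  real_airy_solution u u1 -> 0 <= a <= b -> u a * u1 a <= u b * u1 b.
Proof.
intros H Hab.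
apply (nondecr_of_derive (fun x => u x * u1 x) (fun x => u1 x * u1 x + u x * (x * u x)) a b).
- lra.
- intros x Hx. now apply real_airy_prod_derive.
- intros x Hx. assert (0 <= x * (u x * u x)) by (apply Rmult_le_pos; nra). nra.
Qed.

(** As [w w'] increases, [w] cannot vanish once [w w'] is positive. *)
Lemma real_airy_stays_pos (w w1 : R -> R) (x0 x : R) :
  real_airy_solution w w1 -> 0 <= x0 <= x -> 0 < w x0 -> 0 < w1 x0 -> 0 < w x.
Proof.
intros H Hx H0 H1.
destruct (Rlt_or_le 0 (w x)) as [Hp|Hn]; trivial. exfalso.
assert (Hc : continuity w).
{ intros t. apply continuity_pt_filterlim.
  apply (ex_derive_continuous (K := R_AbsRing) (V := R_NormedModule) w).
  exists (w1 t). apply H. }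
destruct (IVT_cor w x0 x Hc ltac:(lra) ltac:(nra)) as [z [Hz Ez]].
assert (A := real_airy_prod_nondecr w w1 x0 z H ltac:(lra)).
rewrite Ez in A. nra.
Qed.

(** If [u u' > 0] somewhere then [u] stays above a positive multiple of [g]
    from there on. *)
Lemma recessive_prod_nonpos (u u1 g g1 : R -> R) :
  real_airy_solution u u1 -> real_airy_solution g g1 ->
  (forall c, 0 < c -> exists X, forall x, X <= x -> Rabs (u x) <= c * g x) ->
  forall x, 0 <= x -> u x * u1 x <= 0.
Proof.
intros Hu Hg Hlim x0 Hx0.
assert (Main : forall v v1, real_airy_solution v v1 ->
   (forall c, 0 < c -> exists X, forall x, X <= x -> v x <= c * g x) ->
   0 < v x0 -> 0 < v1 x0 -> False).
{ intros v v1 Hv Hl P P1.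
  set (c := Rmin (v x0 / (Rabs (g x0) + 1)) (v1 x0 / (Rabs (g1 x0) + 1))).
  assert (A := Rabs_pos (g x0)). assert (A1 := Rabs_pos (g1 x0)).
  assert (Hc : 0 < c) by (apply Rmin_pos; apply Rdiv_lt_0_compat; lra).
  assert (B : c * (Rabs (g x0) + 1) <= v x0).
  { apply Rle_trans with (v x0 / (Rabs (g x0) + 1) * (Rabs (g x0) + 1)).
    - apply Rmult_le_compat_r; [lra|apply Rmin_l].
    - right; field; lra. }
  assert (B1 : c * (Rabs (g1 x0) + 1) <= v1 x0).
  { apply Rle_trans with (v1 x0 / (Rabs (g1 x0) + 1) * (Rabs (g1 x0) + 1)).
    - apply Rmult_le_compat_r; [lra|apply Rmin_r].
    - right; field; lra. }
  assert (D := Rle_abs (g x0)). assert (D1 := Rle_abs (g1 x0)).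
  destruct (Hl c Hc) as [X HX].
  set (x := Rmax X x0). assert (Mx := Rmax_l X x0). assert (Mx0 := Rmax_r X x0).
  assert (S := real_airy_solution_lin v v1 g g1 (- c) Hv Hg).
  assert (P2 := real_airy_stays_pos _ _ x0 x S ltac:(unfold x; lra)).
  cbv beta in P2.
  specialize (P2 ltac:(nra) ltac:(nra)).
  specialize (HX x Mx). lra. }
destruct (Rle_or_lt (u x0 * u1 x0) 0) as [|Hp]; trivial. exfalso.
destruct (Rlt_or_le 0 (u x0)) as [P|N].
- apply (Main u u1); trivial; [|nra].
  intros c Hc. destruct (Hlim c Hc) as [X HX]. exists X. intros x Hx.
  specialize (HX x Hx). assert (A := Rle_abs (u x)). lra.
- apply (Main (fun x => u x + -2 * u x) (fun x => u1 x + -2 * u1 x)).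
  + now apply real_airy_solution_lin.
  + intros c Hc. destruct (Hlim c Hc) as [X HX]. exists X. intros x Hx.
    specialize (HX x Hx). assert (A := Rle_abs (- u x)). rewrite Rabs_Ropp in A. lra.
  + assert (u x0 <> 0) by nra. lra.
  + nra.
Qed.

Lemma real_airy_sq_nonincr (u u1 : R -> R) (a b : R) :
  real_airy_solution u u1 -> (forall x, 0 <= x -> u x * u1 x <= 0) ->
  0 <= a <= b -> u b * u b <= u a * u a.
Proof.
intros H Hs Hab.
apply (nonincr_of_derive (fun x => u x * u x) (fun x => u1 x * u x + u x * u1 x) a b).
- lra.
- intros x Hx. destruct (H x). now apply is_derive_prod.
- intros x Hx. specialize (Hs x ltac:(lra)). nra.
Qed.

Lemma is_derive_exp_lin (b x : R) : is_derive (fun x => exp (b * x)) x (b * exp (b * x)).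
Proof. auto_derive; trivial. as_real; ring. Qed.

(** With [q = u^2] one has [q'' >= 2 x q >= b^2 q] for [x >= b^2], so a positive
    value of [q' + b q] would make [q] grow like [exp (b x)]. *)
Lemma recessive_log_derivative (u u1 : R -> R) (b x : R) :
  real_airy_solution u u1 -> (forall x, 0 <= x -> u x * u1 x <= 0) ->
  0 < b -> b ^ 2 <= x -> 2 * (u x * u1 x) + b * (u x * u x) <= 0.
Proof.
intros H Hs Hb Hx.
set (v := fun x => 2 * (u x * u1 x) + b * (u x * u x)).
destruct (Rle_or_lt (v x) 0) as [|Hv]; trivial. exfalso.
assert (Hb2 : 0 < b ^ 2) by nra.
(* At [y] the lower bound [v x exp (b (y - x))], already through
   [exp s >= 1 + s], exceeds the upper bound [b (u x)^2] for [v y]. *)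
set (y := x + u x * u x / v x).
assert (Hy : 0 <= u x * u x / v x) by (apply Rdiv_le_0_compat; nra).
assert (A : v x * exp (- b * x) <= v y * exp (- b * y)).
{ apply (nondecr_of_derive (fun x => v x * exp (- b * x))
    (fun x => (2 * (u1 x * u1 x + u x * (x * u x)) + b * (u1 x * u x + u x * u1 x)) * exp (- b * x)
       + v x * (- b * exp (- b * x)))).
  - unfold y; lra.
  - intros t Ht.
    refine (is_derive_prod v _ t _ _ _ (is_derive_exp_lin (- b) t)).
    destruct (H t) as [D D1].
    exact (is_derive_plus _ _ _ _ _
      (is_derive_scal _ _ 2 _ (real_airy_prod_derive u u1 t H))
      (is_derive_scal _ _ b _ (is_derive_prod u u t _ _ D D))).
  - intros t Ht. unfold v.
    replace ((2 * (u1 t * u1 t + u t * (t * u t)) + b * (u1 t * u t + u t * u1 t)) * exp (- b * t) +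
      (2 * (u t * u1 t) + b * (u t * u t)) * (- b * exp (- b * t)))
      with ((2 * u1 t ^ 2 + (2 * t - b ^ 2) * u t ^ 2) * exp (- b * t)) by ring.
    apply Rmult_le_pos; [|left; apply exp_pos].
    apply Rplus_le_le_0_compat.
    + assert (B := pow2_ge_0 (u1 t)). lra.
    + apply Rmult_le_pos; [lra|apply pow2_ge_0]. }
assert (B : v x * exp (b * (y - x)) <= v y).
{ replace (b * (y - x)) with (- b * x + b * y) by ring. rewrite exp_plus.
  assert (E : exp (- b * y) * exp (b * y) = 1)
    by (rewrite <- exp_plus, <- exp_0; f_equal; ring).
  assert (P := exp_pos (b * y)).
  apply Rmult_le_compat_r with (r := exp (b * y)) in A; [|lra].
  replace (v y) with (v y * (exp (- b * y) * exp (b * y))) by (rewrite E; ring). lra. }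
assert (C : v y <= b * (u x * u x)).
{ assert (C1 := Hs y ltac:(unfold y; lra)).
  assert (C2 := real_airy_sq_nonincr u u1 x y H Hs ltac:(unfold y; lra)).
  unfold v. nra. }
assert (D := exp_ineq1_le (b * (y - x))).
assert (E : v x * (b * (y - x)) = b * (u x * u x)) by (unfold y; field; lra).
nra.
Qed.

(** The previous lemma says that [u^2 e^(b x)] is nonincreasing.  For [u'], the
    function [u'^2] is nonincreasing and [(u u')' >= u'^2], so two unit steps
    to the left bound [u'(x)^2] by [u(x - 2)^2]. *)
Lemma recessive_decay (u u1 : R -> R) (b : R) :
  real_airy_solution u u1 -> (forall x, 0 <= x -> u x * u1 x <= 0) -> 0 < b ->
  exists C X, 0 < C /\ 0 <= X /\ forall x, X <= x ->
    u x * u x + u1 x * u1 x <= C * exp (- b * x).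
Proof.
intros H Hs Hb.
set (X := b ^ 2). assert (HX : 0 < X) by (unfold X; nra).
set (C0 := u X * u X * exp (b * X)).
assert (HC0 : 0 <= C0) by (apply Rmult_le_pos; [nra|left; apply exp_pos]).
assert (Hu : forall x, X <= x -> u x * u x <= C0 * exp (- b * x)).
{ intros x Hx.
  assert (A : u x * u x * exp (b * x) <= u X * u X * exp (b * X)).
  { apply (nonincr_of_derive (fun x => u x * u x * exp (b * x))
      (fun x => (u1 x * u x + u x * u1 x) * exp (b * x) + u x * u x * (b * exp (b * x))) X x).
    - trivial.
    - intros t Ht.
      refine (is_derive_prod (fun x => u x * u x) _ t _ _ _ (is_derive_exp_lin b t)).
      destruct (H t). now apply is_derive_prod.
    - intros t Ht. assert (L := recessive_log_derivative u u1 b t H Hs Hb ltac:(fold X; lra)).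
      assert (P := exp_pos (b * t)). nra. }
  fold C0 in A.
  assert (E : exp (- b * x) * exp (b * x) = 1)
    by (rewrite <- exp_plus, <- exp_0; f_equal; ring).
  assert (P := exp_pos (- b * x)).
  apply Rmult_le_compat_r with (r := exp (- b * x)) in A; [|lra].
  replace (u x * u x) with (u x * u x * (exp (- b * x) * exp (b * x))) by (rewrite E; ring). lra. }
exists (C0 + C0 * exp (b * 2) + 1), (X + 2).
assert (P2 := exp_pos (b * 2)).
split; [nra|]. split; [lra|].
intros x Hx.
assert (H1 := Hu x ltac:(lra)).
assert (Hmono : forall s, 0 <= s <= x -> u1 x * u1 x <= u1 s * u1 s).
{ intros s Hsx. apply (nonincr_of_derive (fun x => u1 x * u1 x)
    (fun x => x * u x * u1 x + u1 x * (x * u x)) s x).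
  - lra.
  - intros t Ht. destruct (H t). now apply is_derive_prod.
  - intros t Ht. specialize (Hs t ltac:(lra)).
    replace (t * u t * u1 t + u1 t * (t * u t)) with (2 * t * (u t * u1 t)) by ring. nra. }
assert (H2 : u1 x * u1 x <= - (u (x - 1) * u1 (x - 1))).
{ assert (A : u (x - 1) * u1 (x - 1) + - (u1 x * u1 x) * (x - 1)
     <= u x * u1 x + - (u1 x * u1 x) * x).
  { apply (nondecr_of_derive (fun s => u s * u1 s + - (u1 x * u1 x) * s)
      (fun s => u1 s * u1 s + u s * (s * u s) + - (u1 x * u1 x) * 1) (x - 1) x).
    - lra.
    - intros t Ht.
      exact (is_derive_plus _ _ _ _ _ (real_airy_prod_derive u u1 t H)
        (is_derive_scal _ _ (- (u1 x * u1 x)) _ (is_derive_id t))).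
    - intros t Ht. specialize (Hmono t ltac:(lra)).
      assert (0 <= t * (u t * u t)) by (apply Rmult_le_pos; nra). nra. }
  specialize (Hs x ltac:(lra)). lra. }
assert (H3 : - (u (x - 1) * u1 (x - 1)) <= u (x - 2) * u (x - 2)).
{ set (p := u (x - 1) * u1 (x - 1)) in *.
  assert (A : u (x - 1) * u (x - 1) + - (2 * p) * (x - 1)
     <= u (x - 2) * u (x - 2) + - (2 * p) * (x - 2)).
  { apply (nonincr_of_derive (fun s => u s * u s + - (2 * p) * s)
      (fun s => u1 s * u s + u s * u1 s + - (2 * p) * 1) (x - 2) (x - 1)).
    - lra.
    - intros t Ht. destruct (H t) as [D _].
      exact (is_derive_plus _ _ _ _ _ (is_derive_prod u u t _ _ D D)
        (is_derive_scal _ _ (- (2 * p)) _ (is_derive_id t))).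
    - intros t Ht. assert (B := real_airy_prod_nondecr u u1 t (x - 1) H ltac:(lra)).
      fold p in B. lra. }
  specialize (Hs (x - 1) ltac:(lra)). fold p in Hs. nra. }
assert (H4 := Hu (x - 2) ltac:(lra)).
replace (- b * (x - 2)) with (b * 2 + - b * x) in H4 by ring. rewrite exp_plus in H4.
assert (P := exp_pos (- b * x)). lra.
Qed.

(** * Energy estimates and zeros *)

Lemma Cdot_le (p q : C) : Re p * Re q + Im p * Im q <= Cmod p * Cmod q.
Proof.
replace (Re p * Re q + Im p * Im q) with (Re (p * Cconj q)%C)
  by (unfold Re, Im; simpl; ring).
rewrite <- (Cmod_conj q), <- Cmod_mult.
eapply Rle_trans; [apply Rle_abs|apply re_le_Cmod].
Qed.

Definition energy (m : R) (W W1 : C -> C) (z : C) : R :=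
  m ^ 2 * Cmod (W z) ^ 2 + Cmod (W1 z) ^ 2.

(** Gronwall along the segment from [z] to [z + d]: weighting [|W|^2] by [m^2],
    where [|z| <= m^2], makes the logarithmic derivative of the energy at most
    [2 m |d|]. *)
Lemma airy_energy_bound (W W1 : C -> C) (z d : C) (m : R) :
  airy_solution W W1 -> 0 < m ->
  (forall t, 0 <= t <= 1 -> Cmod (z + RtoC t * d) <= m ^ 2) ->
  energy m W W1 (z + d)%C <= energy m W W1 z * exp (2 * m * Cmod d).
Proof.
intros [HW HW1] Hm Hz.
set (k := 2 * m * Cmod d).
set (p := fun t : R => (z + RtoC t * d)%C).
set (A := fun t => Re (W (p t))). set (B := fun t => Im (W (p t))).
set (A1 := fun t => Re (W1 (p t))). set (B1 := fun t => Im (W1 (p t))).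
set (a := fun t => Re (d * W1 (p t))%C). set (b := fun t => Im (d * W1 (p t))%C).
set (a1 := fun t => Re (d * (p t * W (p t)))%C). set (b1 := fun t => Im (d * (p t * W (p t)))%C).
set (N := fun t => m ^ 2 * (A t * A t + B t * B t) + (A1 t * A1 t + B1 t * B1 t)).
set (dN := fun t => m ^ 2 * (a t * A t + A t * a t + (b t * B t + B t * b t)) +
  (a1 t * A1 t + A1 t * a1 t + (b1 t * B1 t + B1 t * b1 t))).
assert (HN : forall t, N t = energy m W W1 (p t)).
{ intros t. unfold energy, N, A, B, A1, B1. rewrite !Cmod2_alt. ring. }
assert (HdN : forall t, is_derive N t (dN t)).
{ intros t.
  destruct (entire_deriv_line W W1 z d t HW) as [DA DB].
  destruct (entire_deriv_line W1 _ z d t HW1) as [DA1 DB1].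
  exact (is_derive_plus _ _ _ _ _
    (is_derive_scal _ _ (m ^ 2) _ (is_derive_plus _ _ _ _ _
      (is_derive_prod A A t _ _ DA DA) (is_derive_prod B B t _ _ DB DB)))
    (is_derive_plus _ _ _ _ _
      (is_derive_prod A1 A1 t _ _ DA1 DA1) (is_derive_prod B1 B1 t _ _ DB1 DB1))). }
assert (Hbound : forall t, 0 <= t <= 1 -> dN t <= k * N t).
{ intros t Ht.
  assert (C1 := Cdot_le (W (p t)) (d * W1 (p t))%C).
  assert (C2 := Cdot_le (W1 (p t)) (d * (p t * W (p t)))%C).
  rewrite !Cmod_mult in C1. rewrite !Cmod_mult in C2.
  fold (A t) (B t) (a t) (b t) in C1. fold (A1 t) (B1 t) (a1 t) (b1 t) in C2.
  rewrite HN. unfold energy, dN, k.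
  assert (Hp := Hz t Ht). fold (p t) in Hp.
  assert (P := Cmod_ge_0 (W (p t))). assert (P1 := Cmod_ge_0 (W1 (p t))).
  assert (Pd := Cmod_ge_0 d). assert (Pp := Cmod_ge_0 (p t)).
  set (w := Cmod (W (p t))) in *. set (w1 := Cmod (W1 (p t))) in *.
  set (D := Cmod d) in *. set (q := Cmod (p t)) in *.
  assert (M2 : 0 < m ^ 2) by nra.
  assert (E1 : 0 <= w * w1 * D) by (apply Rmult_le_pos; [nra|trivial]).
  assert (E2 : w1 * (D * (q * w)) <= m ^ 2 * (w * w1 * D)).
  { replace (w1 * (D * (q * w))) with (q * (w * w1 * D)) by ring.
    now apply Rmult_le_compat_r. }
  assert (E3 : m ^ 2 * (A t * a t + B t * b t) <= m ^ 2 * (w * w1 * D))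
    by (apply Rmult_le_compat_l; lra).
  assert (E4 : 0 <= 2 * m * D * (m * w - w1) ^ 2).
  { apply Rmult_le_pos; [|apply pow2_ge_0]. apply Rmult_le_pos; lra. }
  nra. }
assert (Hfin : N 1 * exp (- k * 1) <= N 0 * exp (- k * 0)).
{ apply (nonincr_of_derive (fun t => N t * exp (- k * t))
    (fun t => dN t * exp (- k * t) + N t * (- k * exp (- k * t))) 0 1).
  - lra.
  - intros t Ht. exact (is_derive_prod N _ t _ _ (HdN t) (is_derive_exp_lin (- k) t)).
  - intros t Ht. specialize (Hbound t Ht). assert (P := exp_pos (- k * t)). nra. }
rewrite !HN in Hfin.
replace (p 0) with z in Hfin by (unfold p; ring).
replace (p 1) with (z + d)%C in Hfin by (unfold p; ring).
rewrite Rmult_0_r, exp_0, Rmult_1_r, Rmult_1_r in Hfin.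
assert (E : exp (- k) * exp k = 1) by (rewrite <- exp_plus, <- exp_0; f_equal; ring).
apply Rmult_le_compat_r with (r := exp k) in Hfin; [|left; apply exp_pos].
rewrite Rmult_assoc, E, Rmult_1_r in Hfin. exact Hfin.
Qed.

Lemma is_derive_zero_right (F : R -> R) (t l : R) :
  (forall s, 0 < s -> F s = 0) -> 0 < t -> is_derive F t l -> l = 0.
Proof.
intros HF Ht D.
rewrite <- (is_derive_unique F t l D).
apply is_derive_unique.
apply is_derive_ext_loc with (fun _ => 0).
- exists (mkposreal t Ht). intros y Hy.
  unfold ball in Hy; simpl in Hy; unfold AbsRing_ball, abs, minus, plus, opp in Hy; simpl in Hy.
  apply Rabs_def2 in Hy. symmetry. apply HF. lra.
- exact (is_derive_const 0 t).
Qed.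

Lemma C_eq_0 (z : C) : Re z = 0 -> Im z = 0 -> z = RtoC 0.
Proof. destruct z as [x y]. simpl. now intros -> ->. Qed.

(** [W] and [W'] vanish at a point of the half-line, and the energy estimate
    carries this to the origin. *)
Lemma airy_solution_vanishing (W W1 : C -> C) (z : C) :
  airy_solution W W1 -> (forall t, 0 < t -> W (z + RtoC t)%C = RtoC 0) -> W (RtoC 0) = RtoC 0.
Proof.
intros H Hz.
assert (H1 : W1 (z + RtoC 1)%C = RtoC 0).
{ destruct H as [HW _].
  destruct (entire_deriv_line W W1 z (RtoC 1) 1 HW) as [D D'].
  assert (Z : forall s, 0 < s -> W (z + RtoC s * RtoC 1)%C = RtoC 0).
  { intros s Hs. replace (z + RtoC s * RtoC 1)%C with (z + RtoC s)%C by ring. now apply Hz. }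
  apply is_derive_zero_right in D; [|intros s Hs; now rewrite Z|lra].
  apply is_derive_zero_right in D'; [|intros s Hs; now rewrite Z|lra].
  replace (RtoC 1 * W1 (z + RtoC 1 * RtoC 1))%C with (W1 (z + RtoC 1)%C) in D, D'
    by (replace (z + RtoC 1 * RtoC 1)%C with (z + RtoC 1)%C by ring; ring).
  now apply C_eq_0. }
set (y := (z + RtoC 1)%C) in *.
assert (H0 : W y = RtoC 0) by (apply Hz; lra).
assert (Hy := Cmod_ge_0 y).
assert (G := airy_energy_bound W W1 y (- y)%C (Cmod y + 1) H ltac:(lra)).
replace (y + - y)%C with (RtoC 0) in G by ring.
unfold energy in G. rewrite H0, H1, Cmod_0 in G.
assert (E : (Cmod y + 1) ^ 2 * Cmod (W (RtoC 0)) ^ 2 + Cmod (W1 (RtoC 0)) ^ 2 <= 0).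
{ eapply Rle_trans; [apply G|right; ring].
  intros t Ht.
  replace (y + RtoC t * - y)%C with (RtoC (1 - t) * y)%C by (rewrite RtoC_minus; ring).
  rewrite Cmod_mult, Cmod_R, Rabs_pos_eq by lra. nra. }
apply Cmod_eq_0.
assert (A := pow2_ge_0 (Cmod (W1 (RtoC 0)))). assert (B := Cmod_ge_0 (W (RtoC 0))).
nra.
Qed.

Definition real_trace (W : C -> C) (x : R) : R := Re (W (RtoC x)).

Lemma airy_solution_restrict (W W1 : C -> C) :
  airy_solution W W1 -> real_airy_solution (real_trace W) (real_trace W1).
Proof.
intros [A B] x.
destruct (entire_deriv_line _ _ (RtoC 0) (RtoC 1) x A) as [D _].
destruct (entire_deriv_line _ _ (RtoC 0) (RtoC 1) x B) as [D1 _].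
assert (E : forall s : R, (RtoC 0 + RtoC s * RtoC 1)%C = RtoC s) by (intros s; ring).
split.
- apply (is_derive_ext (fun s : R => Re (W (RtoC 0 + RtoC s * RtoC 1)%C))); [intros t; now rewrite E|].
  replace (real_trace W1 x) with (Re (RtoC 1 * W1 (RtoC 0 + RtoC x * RtoC 1))%C); [exact D|].
  rewrite E. unfold real_trace. f_equal. ring.
- apply (is_derive_ext (fun s : R => Re (W1 (RtoC 0 + RtoC s * RtoC 1)%C))); [intros t; now rewrite E|].
  replace (x * real_trace W x) with
    (Re (RtoC 1 * ((RtoC 0 + RtoC x * RtoC 1) * W (RtoC 0 + RtoC x * RtoC 1)))%C); [exact D1|].
  rewrite E. unfold real_trace, Re. simpl. ring.
Qed.

Definition recessive_solution (W W1 : C -> C) : Prop :=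
  airy_solution W W1 /\
  (forall x : R, Im (W (RtoC x)) = 0) /\
  (forall x : R, Im (W1 (RtoC x)) = 0) /\
  (forall x : R, 0 <= x -> real_trace W x * real_trace W1 x <= 0).

(** The vertical energy estimate loses a factor of the form
    [exp (c (x + 1))], which the decay on the real axis absorbs at any rate. *)
Lemma recessive_strip_decay (W W1 : C -> C) (y : R) :
  recessive_solution W W1 ->
  exists K X, forall x, X <= x ->
    Cmod (W (x, y)) ^ 2 + Cmod (W1 (x, y)) ^ 2 <= K * exp (- x).
Proof.
intros (HW & Wreal & W1real & Wrec).
assert (Hu := airy_solution_restrict W W1 HW).
set (u := real_trace W) in *. set (u1 := real_trace W1) in *.
assert (Hy := Rabs_pos y). set (Y := Rabs y) in *.
(* The estimate costs at most [exp ((1 + 2 Y) (x + 1 + Y))], using [m <= m^2];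
   the rate [2 + 2 Y] leaves [exp (- x)]. *)
destruct (recessive_decay u u1 (2 + 2 * Y) Hu Wrec ltac:(lra))
  as [K [X [HK [HX HD]]]].
exists (K * exp ((1 + 2 * Y) * (1 + Y))), X. intros x Hx.
set (m := sqrt (x + 1 + Y)).
assert (Hm2 : m ^ 2 = x + 1 + Y) by (unfold m; rewrite pow2_sqrt; lra).
assert (Hm1 : 1 <= m).
{ unfold m. rewrite <- sqrt_1 at 1. apply sqrt_le_1; lra. }
assert (G := airy_energy_bound W W1 (RtoC x) (0, y) m HW ltac:(lra)).
replace (RtoC x + (0, y))%C with ((x, y) : C) in G
  by (unfold RtoC, Cplus; simpl; f_equal; ring).
assert (Cy : Cmod (0, y) = Y).
{ unfold Cmod. simpl. unfold Y. rewrite <- sqrt_Rsqr_abs. f_equal. unfold Rsqr. ring. }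
rewrite Cy in G.
specialize (G ltac:(intros t Ht; rewrite Hm2;
  eapply Rle_trans; [apply Cmod_triangle|];
  rewrite Cmod_mult, !Cmod_R, Cy, !Rabs_pos_eq by lra; nra)).
assert (EW : Cmod (W (RtoC x)) ^ 2 = u x * u x).
{ rewrite Cmod2_alt, Wreal. unfold u, real_trace. ring. }
assert (EW1 : Cmod (W1 (RtoC x)) ^ 2 = u1 x * u1 x).
{ rewrite Cmod2_alt, W1real. unfold u1, real_trace. ring. }
unfold energy in G. rewrite EW, EW1, Hm2 in G.
assert (B := HD x Hx).
assert (Em := exp_ineq1_le (x + Y)).
assert (P1 := pow2_ge_0 (Cmod (W (x, y)))). assert (P2 := pow2_ge_0 (Cmod (W1 (x, y)))).
apply Rle_trans with ((x + 1 + Y) * Cmod (W (x, y)) ^ 2 + Cmod (W1 (x, y)) ^ 2); [nra|].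
apply Rle_trans with (1 := G).
apply Rle_trans with (exp (x + 1 + Y) * (K * exp (- (2 + 2 * Y) * x)) * exp (2 * (x + 1 + Y) * Y)).
- apply Rmult_le_compat.
  + nra.
  + left; apply exp_pos.
  + apply Rle_trans with ((x + 1 + Y) * (u x * u x + u1 x * u1 x)); [nra|].
    apply Rmult_le_compat; [lra|nra| |exact B].
    assert (E := exp_ineq1_le (x + 1 + Y)). lra.
  + assert (E : 2 * m * Y <= 2 * (x + 1 + Y) * Y).
    { apply Rmult_le_compat_r; trivial. rewrite <- Hm2. nra. }
    destruct E as [E|E]; [left; now apply exp_increasing|right; now rewrite E].
- right.
  replace (exp (x + 1 + Y) * (K * exp (- (2 + 2 * Y) * x)) * exp (2 * (x + 1 + Y) * Y)) with
    (K * (exp (x + 1 + Y) * exp (- (2 + 2 * Y) * x) * exp (2 * (x + 1 + Y) * Y))) by ring.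
  rewrite (Rmult_assoc K), <- !exp_plus. do 2 f_equal. ring.
Qed.

Lemma recessive_zeros_negative (W W1 : C -> C) (z : C) :
  recessive_solution W W1 -> W (RtoC 0) <> RtoC 0 -> W z = RtoC 0 -> Im z = 0 /\ Re z < 0.
Proof.
intros Hrec HW0 Hz.
assert (Hdecay := fun y => recessive_strip_decay W W1 y Hrec).
destruct Hrec as (HW & Wreal & W1real & Wrec).
assert (Hu := airy_solution_restrict W W1 HW).
set (u := real_trace W) in *. set (u1 := real_trace W1) in *.
destruct z as [x0 y0]. simpl.
destruct (Req_dec y0 0) as [->|Hy0].
- split; trivial.
  destruct (Rlt_or_le x0 0) as [|Hx0]; trivial. exfalso. apply HW0.
  apply (airy_solution_vanishing W W1 (RtoC x0) HW).
  intros t Ht. rewrite <- RtoC_plus.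
  apply C_eq_0; [|apply Wreal].
  assert (A := real_airy_sq_nonincr u u1 x0 (x0 + t) Hu Wrec ltac:(lra)).
  assert (B : u x0 = 0) by (unfold u, real_trace, RtoC; now rewrite Hz).
  change (Re (W (RtoC (x0 + t)))) with (u (x0 + t)). rewrite B in A. nra.
- exfalso. apply HW0. apply (airy_solution_vanishing W W1 (x0, y0) HW).
  set (z0 := (x0, y0) : C) in *.
  set (p := fun t : R => (z0 + RtoC t * RtoC 1)%C).
  (* [J = Im (W' conj W)]; the term [|W'|^2] of its derivative is real. *)
  set (J := fun t => Im (W1 (p t)) * Re (W (p t)) + -1 * (Re (W1 (p t)) * Im (W (p t)))).
  assert (HJ : forall t, is_derive J t (y0 * Cmod (W (p t)) ^ 2)).
  { intros t. destruct HW as [A B].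
    destruct (entire_deriv_line _ _ z0 (RtoC 1) t A) as [DA DB].
    destruct (entire_deriv_line _ _ z0 (RtoC 1) t B) as [DA1 DB1].
    assert (D := is_derive_plus _ _ _ _ _ (is_derive_prod _ _ t _ _ DB1 DA)
      (is_derive_scal _ _ (-1) _ (is_derive_prod _ _ t _ _ DA1 DB))).
    match type of D with is_derive _ _ ?l => replace (y0 * Cmod (W (p t)) ^ 2) with l end.
    - exact D.
    - rewrite Cmod2_alt.
      assert (Ip : Im (p t) = y0) by (unfold p, Im; simpl; ring).
      cbv beta. change (z0 + RtoC t * RtoC 1)%C with (p t). rewrite <- Ip.
      destruct (W (p t)) as [a b]. destruct (W1 (p t)) as [a1 b1]. destruct (p t) as [x y].
      change plus with Rplus. unfold Re, Im. simpl.
      ring. }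
  assert (J0 : J 0 = 0).
  { unfold J. replace (p 0) with z0 by (unfold p; ring). rewrite Hz. simpl. ring. }
  assert (Hmono : forall s t, s <= t -> y0 * J s <= y0 * J t).
  { intros s t Hst. apply (nondecr_of_derive (fun t => y0 * J t)
      (fun t => y0 * (y0 * Cmod (W (p t)) ^ 2))); trivial.
    - intros r Hr. exact (is_derive_scal _ _ y0 _ (HJ r)).
    - intros r Hr. assert (A := pow2_ge_0 (Cmod (W (p r)))).
      rewrite <- Rmult_assoc. apply Rmult_le_pos; nra. }
  destruct (Hdecay y0) as [K [X HX]].
  assert (Hle : forall t, y0 * J t <= 0).
  { intros t. destruct (Rle_or_lt (y0 * J t) 0) as [|Hpos]; trivial. exfalso.
    set (e := y0 * J t) in *.
    (* Far enough right that [|y0 K| exp (- s)] is below [e]. *)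
    set (s := Rabs X + Rabs t + Rabs x0 + Rabs y0 * Rabs K / e).
    assert (Q : 0 <= Rabs y0 * Rabs K / e).
    { apply Rdiv_le_0_compat; trivial. apply Rmult_le_pos; apply Rabs_pos. }
    assert (B1 := Rle_abs X). assert (B2 := Rle_abs t). assert (B3 := Rle_abs x0).
    assert (B4 := Rabs_pos X). assert (B5 := Rabs_pos t).  assert (B6 := Rabs_pos x0).
    assert (Ht : e <= y0 * J (s - x0)) by (apply Hmono; unfold s; lra).
    assert (Hs := HX s ltac:(unfold s; lra)).
    assert (Ep : p (s - x0) = (s, y0)).
    { unfold p, z0, RtoC, Cplus, Cmult; simpl. f_equal; ring. }
    assert (HJb : Rabs (J (s - x0)) <= Rabs K * exp (- s)).
    { apply Rle_trans with (Cmod (W (s, y0)) ^ 2 + Cmod (W1 (s, y0)) ^ 2).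
      - unfold J. rewrite Ep, !Cmod2_alt. apply Rabs_le.
        set (a := Re (W (s, y0))). set (b := Im (W (s, y0))).
        set (a1 := Re (W1 (s, y0))). set (b1 := Im (W1 (s, y0))).
        assert (S1 := pow2_ge_0 (b1 - a)). assert (S2 := pow2_ge_0 (b1 + a)).
        assert (S3 := pow2_ge_0 (a1 - b)). assert (S4 := pow2_ge_0 (a1 + b)).
        split; nra.
      - apply Rle_trans with (1 := Hs). apply Rmult_le_compat_r; [left; apply exp_pos|apply Rle_abs]. }
    assert (HyJ : y0 * J (s - x0) <= Rabs y0 * Rabs K * exp (- s)).
    { apply Rle_trans with (Rabs (y0 * J (s - x0))); [apply Rle_abs|].
      rewrite Rabs_mult, Rmult_assoc. apply Rmult_le_compat_l; [apply Rabs_pos|exact HJb]. }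
    assert (E : exp (- s) * exp s = 1) by (rewrite <- exp_plus, <- exp_0; f_equal; ring).
    assert (E1 := exp_ineq1_le s).
    assert (E2 : e * exp s <= Rabs y0 * Rabs K).
    { replace (Rabs y0 * Rabs K) with (Rabs y0 * Rabs K * (exp (- s) * exp s)) by (rewrite E; ring).
      rewrite <- Rmult_assoc. apply Rmult_le_compat_r; [left; apply exp_pos|lra]. }
    assert (E3 : e * (Rabs y0 * Rabs K / e) = Rabs y0 * Rabs K) by (field; lra).
    assert (E4 : e * (1 + Rabs y0 * Rabs K / e) <= e * exp s).
    { apply Rmult_le_compat_l; [lra|]. apply Rle_trans with (1 + s); [unfold s; lra|exact E1]. }
    lra. }
  assert (HJz : forall t, 0 < t -> J t = 0).
  { intros t Ht. assert (A := Hmono 0 t ltac:(lra)). rewrite J0 in A.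
    assert (B := Hle t). assert (y0 * J t = 0) by lra. nra. }
  intros t Ht.
  assert (D := is_derive_zero_right J t _ HJz Ht (HJ t)).
  replace (z0 + RtoC t)%C with (p t) by (unfold p; ring).
  apply Cmod_eq_0. assert (A := Cmod_ge_0 (W (p t))).
  apply Rmult_integral in D. destruct D as [|D]; [lra|]. nra.
Qed.

(** * The recessive combination of the two series *)

Lemma is_series_real_point (c : nat -> R) (d : nat -> nat) (x : R) (l : C) :
  is_series (fun k => RtoC (c k) * RtoC x ^ d k)%C l ->
  is_series (fun k => c k * x ^ d k) (Re l).
Proof.
intros H. apply is_series_Re in H.
eapply is_series_ext; [|exact H].
intros k; cbv beta. rewrite <- RtoC_pow, <- RtoC_mult. reflexivity.
Qed.

Lemma entire_coef_pos (c : nat -> R) (d : nat -> nat) :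
  (forall k, 0 < c k) -> (forall z, ex_series (fun k => RtoC (c k) * z ^ d k)%C) ->
  entire_coef c d.
Proof.
intros Hc H r Hr. destruct (H (RtoC r)) as [l Hl].
exists (Re l). apply is_series_real_point in Hl.
eapply is_series_ext; [|exact Hl].
intros k; cbv beta. rewrite Rabs_pos_eq; trivial. left; apply Hc.
Qed.

Lemma airy_f_solution : exists f1, airy_solution airy_f f1 /\ forall x : R, Im (f1 (RtoC x)) = 0.
Proof.
exists (power_sum (deriv_coef airy_f_coef (fun k => 3 * k + 0)%nat) (fun k => pred (3 * k + 0))).
split; [|intros x; apply power_sum_Im].
assert (E : forall z, power_sum airy_f_coef (fun k => 3 * k + 0)%nat z = airy_f z).
{ intros z. apply power_sum_ext with (d' := fun k => (3 * k)%nat).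
  intros k. now rewrite Nat.add_0_r. }
destruct (power_sum_airy_solution airy_f_coef 0) as [H H1].
- apply entire_coef_pos; [apply airy_f_coef_pos|].
  intros z. destruct (ex_series_airy_f z) as [l Hl]. exists l.
  eapply is_series_ext; [|exact Hl]. intros k; cbv beta. now rewrite Nat.add_0_r.
- lia.
- intros k. rewrite <- (airy_f_coef_rec k).
  replace (pred (3 * S k + 0)) with (3 * k + 2)%nat by lia.
  replace (3 * S k + 0)%nat with (3 * k + 3)%nat by lia.
  rewrite !plus_INR, !mult_INR. simpl (INR 3). simpl (INR 2). ring.
- split; [apply (entire_deriv_ext _ _ _ _ E (fun z => eq_refl) H)|].
  apply (entire_deriv_ext _ _ _ _ (fun z => eq_refl)) with (2 := H1).
  intros z. now rewrite E.
Qed.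

Lemma airy_g_solution : exists g1, airy_solution airy_g g1 /\ forall x : R, Im (g1 (RtoC x)) = 0.
Proof.
exists (power_sum (deriv_coef airy_g_coef (fun k => 3 * k + 1)%nat) (fun k => pred (3 * k + 1))).
split; [|intros x; apply power_sum_Im].
apply (power_sum_airy_solution airy_g_coef 1).
- apply entire_coef_pos; [apply airy_g_coef_pos|apply ex_series_airy_g].
- lia.
- intros k. rewrite <- (airy_g_coef_rec k).
  replace (pred (3 * S k + 1)) with (3 * k + 3)%nat by lia.
  replace (3 * S k + 1)%nat with (3 * k + 4)%nat by lia.
  rewrite !plus_INR, !mult_INR. simpl (INR 3). simpl (INR 4). ring.
Qed.

(** [Ai / Ai(0)]. *)
Definition airy_recessive (z : C) : C := (airy_f z + RtoC (- airy_ratio) * airy_g z)%C.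

Lemma is_series_airy_f_real (x : R) :
  is_series (fun k => airy_f_coef k * x ^ (3 * k)) (real_trace airy_f x).
Proof. apply is_series_real_point, is_series_airy_f. Qed.

Lemma is_series_airy_g_real (x : R) :
  is_series (fun k => airy_g_coef k * x ^ (3 * k + 1)) (real_trace airy_g x).
Proof. apply (is_series_real_point _ (fun k => 3 * k + 1)%nat), is_series_airy_g. Qed.

Lemma real_trace_airy_recessive (x : R) :
  real_trace airy_recessive x = real_trace airy_f x + - airy_ratio * real_trace airy_g x.
Proof. unfold real_trace, airy_recessive, Re. simpl. ring. Qed.

Lemma airy_recessive_small (c : R) : 0 < c ->
  exists X, forall x, X <= x -> Rabs (real_trace airy_recessive x) <= c * real_trace airy_g x.
Proof.
intros Hc. assert (Hr := airy_ratio_pos).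
(* With [e <= 1/2] both bounds are at most [2 e ratio g]. *)
set (e := Rmin (1 / 2) (c / (2 * airy_ratio))).
assert (He : 0 < e) by (apply Rmin_pos; [lra|apply Rdiv_lt_0_compat; lra]).
assert (He1 := Rmin_l (1 / 2) (c / (2 * airy_ratio))). fold e in He1.
assert (He2 : 2 * e * airy_ratio <= c).
{ replace c with (2 * (c / (2 * airy_ratio)) * airy_ratio) by (field; lra).
  apply Rmult_le_compat_r; [lra|]. apply Rmult_le_compat_l; [lra|apply Rmin_r]. }
destruct (airy_f_g_asymptotic e He) as [X [HX H]].
exists X. intros x Hx.
destruct (H x _ _ Hx (is_series_airy_f_real x) (is_series_airy_g_real x)) as [H1 H2].
assert (Hg : 0 <= real_trace airy_g x).
{ refine (is_series_nonneg _ _ _ (is_series_airy_g_real x)). intros k. left.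
  apply Rmult_lt_0_compat; [apply airy_g_coef_pos|apply pow_lt; lra]. }
rewrite real_trace_airy_recessive.
set (p := real_trace airy_f x) in *. set (q := real_trace airy_g x) in *.
assert (Hrq : 0 <= airy_ratio * q) by nra.
assert (Hb : 2 * e * airy_ratio * q <= c * q) by (apply Rmult_le_compat_r; lra).
assert (Hp : p <= 2 * (airy_ratio * q)) by nra.
apply Rabs_le. split; nra.
Qed.

Lemma Im_real_lin (a b : C) (c : R) : Im (a + RtoC c * b)%C = Im a + c * Im b.
Proof. unfold Im. simpl. ring. Qed.

Lemma airy_recessive_solution : exists W1, recessive_solution airy_recessive W1.
Proof.
destruct airy_f_solution as [f1 [Hf If]]. destruct airy_g_solution as [g1 [Hg Ig]].
exists (fun z => f1 z + RtoC (- airy_ratio) * g1 z)%C.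
assert (H := airy_solution_lin _ _ _ _ (RtoC (- airy_ratio)) Hf Hg).
split; [exact H|]. split; [|split].
- intros x. unfold airy_recessive. rewrite Im_real_lin.
  change (airy_f (RtoC x)) with (power_sum airy_f_coef (fun k => 3 * k)%nat (RtoC x)).
  change (airy_g (RtoC x)) with (power_sum airy_g_coef (fun k => 3 * k + 1)%nat (RtoC x)).
  rewrite !power_sum_Im. ring.
- intros x. rewrite Im_real_lin, If, Ig. ring.
- exact (recessive_prod_nonpos _ _ _ _ (airy_solution_restrict _ _ H)
    (airy_solution_restrict _ _ Hg) airy_recessive_small).
Qed.

Lemma airy_recessive_0 : airy_recessive (RtoC 0) <> RtoC 0.
Proof.
intros H.
assert (E : real_trace airy_recessive 0 = 0) by (unfold real_trace; now rewrite H).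
rewrite real_trace_airy_recessive in E.
assert (Hf : 0 < real_trace airy_f 0).
{ assert (A := is_series_nonneg _ _ (fun k => Rmult_le_pos _ _ (Rlt_le _ _ (airy_f_coef_pos (S k)))
     (pow_le 0 (3 * S k) (Rle_refl 0))) (is_series_tail _ _ (is_series_airy_f_real 0))).
  assert (B := airy_f_coef_pos 0). cbv beta in A. change (0 ^ (3 * 0)) with 1 in A. lra. }
assert (Hg : real_trace airy_g 0 = 0).
{ assert (Z : forall k, airy_g_coef k * 0 ^ (3 * k + 1) = 0)
    by (intros k; rewrite Nat.add_1_r; simpl; ring).
  assert (S := is_series_airy_g_real 0).
  apply Rle_antisym; [|refine (is_series_nonneg _ _ _ S); intros k; rewrite Z; lra].
  refine (Ropp_le_cancel _ _ _). rewrite Ropp_0.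
  assert (A := is_series_lin _ _ (-1) 0 _ _ S S).
  apply is_series_nonneg in A; [lra|]. intros k; cbv beta. rewrite Z. lra. }
rewrite Hg in E. lra.
Qed.

(** * Rotation by a cube root of unity *)

(** [e^(-2 i pi / 3)] *)
Definition omega : C := (- (1 / 2), - (sqrt 3 / 2)).

Lemma sqrt3_sq : sqrt 3 * sqrt 3 = 3.
Proof. apply sqrt_sqrt; lra. Qed.

Lemma omega_cube : (omega ^ 3 = RtoC 1)%C.
Proof.
assert (H := sqrt3_sq).
assert (H' : sqrt 3 * sqrt 3 * sqrt 3 = 3 * sqrt 3) by now rewrite H.
unfold omega, RtoC. simpl. unfold Cmult. simpl. f_equal; lra.
Qed.

Lemma omega_pow_3k (k : nat) : (omega ^ (3 * k) = RtoC 1)%C.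
Proof. rewrite Cpow_mult_r, omega_cube. apply Cpow_1_l. Qed.

Lemma airy_f_rot (z : C) : airy_f (omega * z)%C = airy_f z.
Proof.
apply CSeries_correct.
eapply is_series_ext; [|exact (is_series_airy_f z)].
intros k; cbv beta. rewrite Cpow_mult_l, omega_pow_3k. symmetry. f_equal. apply Cmult_1_l.
Qed.

Lemma airy_g_rot (z : C) : airy_g (omega * z)%C = (omega * airy_g z)%C.
Proof.
apply CSeries_correct.
eapply is_series_ext; [|exact (is_series_scal omega _ _ (is_series_airy_g z))].
intros k; cbv beta.
change (omega * (RtoC (airy_g_coef k) * z ^ (3 * k + 1)) =
  RtoC (airy_g_coef k) * (omega * z) ^ (3 * k + 1))%C.
rewrite Cpow_mult_l, !Cpow_add_r, omega_pow_3k, !Cpow_1_r. ring.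
Qed.

(** The factor [1 + i sqrt 3] is [2 e^(i pi / 3)], and its product with [omega]
    is [1 - i sqrt 3], which turns the coefficients of [Ai] into those of
    [Ai + i Bi]. *)
Lemma frakA_rot (z : C) :
  frakA z = (- Ci * RtoC (sqrt PI) * RtoC airy_c1 * (RtoC 1 + Ci * RtoC (sqrt 3)) *
    airy_recessive (omega * z))%C.
Proof.
unfold frakA, Ai, Bi, airy_recessive. rewrite airy_f_rot, airy_g_rot.
assert (Hc := airy_c1_pos).
assert (E : RtoC airy_c2 = (RtoC airy_c1 * RtoC airy_ratio)%C).
{ rewrite <- RtoC_mult. f_equal. unfold airy_ratio. field. lra. }
assert (Ew : ((RtoC 1 + Ci * RtoC (sqrt 3)) * omega = RtoC 1 - Ci * RtoC (sqrt 3))%C).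
{ assert (H := sqrt3_sq). unfold omega, Ci, RtoC, Cminus, Copp, Cplus, Cmult. simpl. f_equal; lra. }
rewrite E, RtoC_opp.
transitivity (- Ci * RtoC (sqrt PI) * RtoC airy_c1 * ((RtoC 1 + Ci * RtoC (sqrt 3)) * airy_f z -
   RtoC airy_ratio * (RtoC 1 - Ci * RtoC (sqrt 3)) * airy_g z))%C; [ring|].
rewrite <- Ew. ring.
Qed.

Theorem proposition2p7 :
  forall z0 : C, ~ on_ray (- (PI / 3)) z0 -> frakA z0 <> RtoC 0.
Proof.
intros z0 Hray Hz. apply Hray.
rewrite frakA_rot in Hz.
assert (Hw : airy_recessive (omega * z0)%C = RtoC 0).
{ apply Cmod_eq_0. apply (f_equal Cmod) in Hz. rewrite !Cmod_mult, Cmod_0 in Hz.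
  assert (P1 : 0 < Cmod (- Ci)%C).
  { apply Cmod_gt_0. intros E. apply (f_equal Im) in E. unfold Im in E. simpl in E. lra. }
  assert (P2 : 0 < Cmod (RtoC (sqrt PI))).
  { rewrite Cmod_R. apply Rabs_pos_lt. assert (A := sqrt_lt_R0 PI PI_RGT_0). lra. }
  assert (P3 : 0 < Cmod (RtoC airy_c1)).
  { rewrite Cmod_R. apply Rabs_pos_lt. assert (A := airy_c1_pos). lra. }
  assert (P4 : 0 < Cmod (RtoC 1 + Ci * RtoC (sqrt 3))%C).
  { apply Cmod_gt_0. intros E. apply (f_equal Re) in E. unfold Re in E. simpl in E. lra. }
  apply Rmult_integral in Hz. destruct Hz as [Hz|Hz]; trivial. exfalso.
  assert (0 < Cmod (- Ci)%C * Cmod (RtoC (sqrt PI)) * Cmod (RtoC airy_c1) *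
    Cmod (RtoC 1 + Ci * RtoC (sqrt 3))%C)
    by (repeat (apply Rmult_lt_0_compat; trivial)).
  lra. }
destruct airy_recessive_solution as [W1 HW].
destruct (recessive_zeros_negative _ _ _ HW airy_recessive_0 Hw) as [HI HR].
exists (- Re (omega * z0)%C). split; [lra|].
assert (H3 := sqrt3_sq).
assert (Ec : cis (- (PI / 3)) = (1 / 2, - (sqrt 3 / 2))).
{ unfold cis. rewrite cos_neg, sin_neg, cos_PI3, sin_PI3. reflexivity. }
rewrite Ec. destruct z0 as [x y]. unfold omega, Re, Im, RtoC, Cmult in *. simpl in *.
assert (Hy : y = - (sqrt 3 * x)) by lra. subst y.
assert (H3x : sqrt 3 * sqrt 3 * x = 3 * x) by now rewrite H3.
assert (H3s : sqrt 3 * (sqrt 3 * sqrt 3 * x) = sqrt 3 * (3 * x)) by now rewrite H3x.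
f_equal; lra.
Qed.
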